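(* Let $\{S_t\}_{t\ge0}$ be the weighted translation semigroup on $L^2(\mathbb{R}_+)$ with symbol $\varphi$, let $t>0$, and suppose that $S_t$ is left invertible. Let $S_t'=S_t(S_t^*S_t)^{-1}$ and $L_t=(S_t')^*$, and let $r(\cdot)$ denote the spectral radius. Then: (1) The point spectrum $\sigma_p(S_t)$ of $S_t$ is empty. (2) The point spectrum of $S_t^*$ contains the disc $D_r=\{z\in\mathbb{C}:|z|<r(L_t)^{-1}\}$ with center the origin and radius $r(L_t)^{-1}$. (3) The spectrum $\sigma(S_t)$ of $S_t$ is the closed disc with center the origin and radius $r(S_t)$.
   Context: $\mathbb{R}_+=[0,\infty)$, and $L^2(\mathbb{R}_+)$ is the Hilbert space of complex-valued square integrable Lebesgue measurable functions on $\mathbb{R}_+$. The symbol $\varphi:\mathbb{R}_+\to(0,\infty)$ is a positive continuous function such that for every $t\in\mathbb{R}_+$ the function $\varphi_t$, given by $\varphi_t(x)=\sqrt{\varphi(x)/\varphi(x-t)}$ for $x\ge t$ and $\varphi_t(x)=0$ for $x<t$, is essentially bounded. The weighted translation semigroup with symbol $\varphi$ is the family of bounded operators $\{S_t\}_{t\ge0}$ on $L^2(\mathbb{R}_+)$ given by $(S_tf)(x)=\sqrt{\varphi(x)/\varphi(x-t)}\,f(x-t)$ for $x\ge t$ and $(S_tf)(x)=0$ for $x<t$. The operator $S_t'$ is called the Cauchy dual of $S_t$. The point spectrum of an operator is its set of eigenvalues. *)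

(* Defs.v *)
From HB Require Import structures.
From mathcomp Require Import all_boot all_order all_algebra.
From mathcomp Require Import all_classical all_reals all_analysis.
From mathcomp Require Import generic_quotient ring_quotient sesquilinear.
From mathcomp Require Import ess_sup_inf complex ring.

Set Implicit Arguments.
Unset Strict Implicit.
Unset Printing Implicit Defensive.

Import Order.TTheory GRing.Theory Num.Theory Num.Def.
Import numFieldNormedType.Exports.

Local Open Scope classical_set_scope.
Local Open Scope complex_scope.
Local Open Scope quotient_scope.
Local Open Scope ring_scope.

Section L2space.
Context {d : measure_display} {T : measurableType d} {R : realType}.
Variable mu : {measure set T -> \bar R}.

(* |f|^2 = (Re f)^2 + (Im f)^2, so f is square integrable iff both of its
   components are. *)
Definition L2pred : {pred T -> R[i]} :=
  [pred f | (@complex.Re R \o f \in Lfun mu 2%:E)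
         && (@complex.Im R \o f \in Lfun mu 2%:E)].

Fact L2pred_submod_closed : submod_closed L2pred.
Proof.
split.
  rewrite inE; apply/andP; split.
    exact: (LfunP (0 : LfunType mu (lee1n 2))).
  exact: (LfunP (0 : LfunType mu (lee1n 2))).
move=> a f g /andP[fR fI] /andP[gR gI].
pose ar := complex.Re a; pose ai := complex.Im a.
have cl := Lfun_submod_closed mu (lee1n 2).
have Z : forall c u, u \in Lfun mu 2%:E -> c *: u \in Lfun mu 2%:E.
  move=> c u uL; rewrite -[c *: u]addr0.
  by apply: cl.2 => //; exact: cl.1.
have D : forall u v, u \in Lfun mu 2%:E -> v \in Lfun mu 2%:E -> u + v \in Lfun mu 2%:E.
  by move=> u v uL vL; rewrite -[u]scale1r; exact: cl.2.
apply/andP; split.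
  have -> : @complex.Re R \o (a *: f + g) =
     (ar *: (@complex.Re R \o f) + (- ai) *: (@complex.Im R \o f)) + (@complex.Re R \o g).
    apply/funext => x; rewrite /ar /ai /= !fctE {ar ai}.
    by case: a (f x) (g x) => ? ? [? ?] [? ?] /=; rewrite /GRing.scale/= mulNr.
  by apply/D => //; apply/D; apply/Z.
have -> : @complex.Im R \o (a *: f + g) =
   (ar *: (@complex.Im R \o f) + ai *: (@complex.Re R \o f)) + (@complex.Im R \o g).
  apply/funext => x; rewrite /ar /ai /= !fctE {ar ai}.
  by case: a (f x) (g x) => ? ? [? ?] [? ?] /=; rewrite /GRing.scale/=.
by apply/D => //; apply/D; apply/Z.
Qed.

HB.instance Definition _ :=
  GRing.isSubmodClosed.Build R[i] (T -> R[i]) L2pred L2pred_submod_closed.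

Record L2fun := MkL2fun { L2fun_val :> T -> R[i]; _ : L2fun_val \in L2pred }.
HB.instance Definition _ := [isSub for L2fun_val].
HB.instance Definition _ := [Choice of L2fun by <:].
HB.instance Definition _ := [SubChoice_isSubLmodule of L2fun by <:].

Definition L2null : {pred L2fun} :=
  fun f => `[< \forall x \ae mu, f x = 0 >].

Fact L2null_zmod_closed : zmod_closed L2null.
Proof.
split; first by apply/asboolP; apply: aeW.
move=> f g /asboolP f0 /asboolP g0; apply/asboolP.
by apply: filterS2 f0 g0 => x /= f0 g0; rewrite -[LHS]/(f x - g x) f0 g0 subr0.
Qed.

HB.instance Definition _ :=
  GRing.isZmodClosed.Build L2fun L2null L2null_zmod_closed.

Definition L2 : Type := Quotient.quot L2null.
HB.instance Definition _ := GRing.Zmodule.on L2.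
HB.instance Definition _ := Quotient.on L2.

Definition L2scale (a : R[i]) : L2 -> L2 := lift_op1 L2 ( *:%R a).

Lemma L2_eqP (f g : L2fun) :
  \pi_L2 f = \pi_L2 g <-> \forall x \ae mu, f x = g x.
Proof.
have -> : (\pi_L2 f = \pi_L2 g) <-> (f - g \in L2null).
  rewrite Quotient.idealrBE; split=> [/eqP|/eqP]; exact.
split=> [/asboolP|fg].
  by apply: filterS => x /eqP; rewrite -[X in X == 0]/(f x - g x) subr_eq0 => /eqP.
apply/asboolP; apply: filterS fg => x fg.
by rewrite -[LHS]/(f x - g x) fg subrr.
Qed.

Lemma L2_reprE (f : L2fun) : \forall x \ae mu, repr (\pi_L2 f) x = f x.
Proof. by apply/L2_eqP; rewrite reprK. Qed.

Lemma L2_addE (f g : L2fun) : \pi_L2 f + \pi_L2 g = \pi_L2 (f + g).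
Proof. exact: esym (@Quotient.pi_add L2fun L2null f g). Qed.

Lemma L2_0E : 0 = \pi_L2 (0 : L2fun).
Proof. by apply: (addIr (\pi_L2 0)); rewrite L2_addE !add0r. Qed.

Lemma L2_scaleE a (f : L2fun) : L2scale a (\pi_L2 f) = \pi_L2 (a *: f).
Proof.
unlock L2scale; apply/L2_eqP; have := L2_reprE f; apply: filterS => x /= fE.
by rewrite -[LHS]/(a *: repr (\pi_L2 f) x) fE.
Qed.

Fact L2scaleA a b (f : L2) : L2scale a (L2scale b f) = L2scale (a * b) f.
Proof. by elim/quotW: f => f; rewrite !L2_scaleE scalerA. Qed.

Fact L2scale1 : left_id 1 L2scale.
Proof. by elim/quotW => f; rewrite L2_scaleE scale1r. Qed.

Fact L2scaleDr : right_distributive L2scale +%R.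
Proof.
move=> a; elim/quotW => f; elim/quotW => g.
by rewrite !L2_scaleE !L2_addE L2_scaleE scalerDr.
Qed.

Fact L2scaleDl (f : L2) : {morph L2scale^~ f : a b / a + b}.
Proof.
by move=> a b; elim/quotW: f => f; rewrite !L2_scaleE L2_addE scalerDl.
Qed.

HB.instance Definition _ := GRing.Zmodule_isLmodule.Build R[i] L2
  L2scaleA L2scale1 L2scaleDr L2scaleDl.

(* The class of f; the default 0 is only taken when f is not square
   integrable. *)
Definition L2class (f : T -> R[i]) : L2 := \pi_L2 (insubd (0 : L2fun) f).

Definition cintegral (f : T -> R[i]) : R[i] :=
  (\int[mu]_x complex.Re (f x)) +i* (\int[mu]_x complex.Im (f x)).

Definition L2dot (f g : L2) : R[i] :=
  cintegral (fun x => repr f x * (repr g x)^*).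

Let intR (f g : L2fun) :
  mu.-integrable setT (EFin \o (fun x => complex.Re (f x * (g x)^*))).
Proof.
have /andP[fR fI] : (f : T -> R[i]) \in L2pred by exact: valP.
have /andP[gR gI] : (g : T -> R[i]) \in L2pred by exact: valP.
have /Lfun1_integrable h1 := Lfun2_mul_Lfun1 fR gR.
have /Lfun1_integrable h2 := Lfun2_mul_Lfun1 fI gI.
have := integrableD measurableT h1 h2; congr (integrable _ _ _).
apply/funext => x /=.
by case: (f x) (g x) => [a b] [c e] /=; rewrite mulrN opprK.
Qed.

Let intI (f g : L2fun) :
  mu.-integrable setT (EFin \o (fun x => complex.Im (f x * (g x)^*))).
Proof.
have /andP[fR fI] : (f : T -> R[i]) \in L2pred by exact: valP.
have /andP[gR gI] : (g : T -> R[i]) \in L2pred by exact: valP.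
have /Lfun1_integrable h1 := Lfun2_mul_Lfun1 fI gR.
have /Lfun1_integrable h2 := Lfun2_mul_Lfun1 fR gI.
have := integrableB measurableT h1 h2; congr (integrable _ _ _).
apply/funext => x /=.
by case: (f x) (g x) => [a b] [c e] /=; rewrite mulrN -EFinB addrC.
Qed.

Lemma L2dotE (f g : L2fun) :
  L2dot (\pi_L2 f) (\pi_L2 g) = cintegral (fun x => f x * (g x)^*).
Proof.
have fE := L2_reprE f; have gE := L2_reprE g.
congr (_ +i* _); congr fine; apply: ae_eq_integral => //.
- by case/integrableP: (intR (repr (\pi_L2 f)) (repr (\pi_L2 g))).
- by case/integrableP: (intR f g).
- by apply: filterS2 fE gE => x fE gE _; rewrite fE gE.
- by case/integrableP: (intI (repr (\pi_L2 f)) (repr (\pi_L2 g))).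
- by case/integrableP: (intI f g).
- by apply: filterS2 fE gE => x fE gE _; rewrite fE gE.
Qed.

Fact L2dot_herm (f g : L2) : L2dot f g = (-1) ^+ false * conjC (L2dot g f).
Proof.
rewrite mul1r /L2dot /cintegral; congr (_ +i* _).
  apply: eq_Rintegral => x _.
  by case: (repr f x) (repr g x) => [a b] [c e] /=; rewrite !mulrN (mulrC a) (mulrC b).
rewrite -mulN1r -RintegralZl//.
apply: eq_Rintegral => x _.
by case: (repr f x) (repr g x) => [a b] [c e] /=; ring.
Qed.

Fact cintegral_linear a (u v : T -> R[i]) :
  mu.-integrable setT (EFin \o (fun x => complex.Re (u x))) ->
  mu.-integrable setT (EFin \o (fun x => complex.Im (u x))) ->
  mu.-integrable setT (EFin \o (fun x => complex.Re (v x))) ->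
  mu.-integrable setT (EFin \o (fun x => complex.Im (v x))) ->
  cintegral (fun x => a * u x + v x) = a * cintegral u + cintegral v.
Proof.
move=> uR uI vR vI; case: a => b c; rewrite /cintegral.
have intZ k w : mu.-integrable setT (EFin \o w) ->
    mu.-integrable setT (EFin \o (fun x => k * w x)).
  exact: integrableZl.
have intD w1 w2 : mu.-integrable setT (EFin \o w1) ->
    mu.-integrable setT (EFin \o w2) ->
    mu.-integrable setT (EFin \o (fun x => w1 x + w2 x)).
  exact: integrableD.
have -> : \int[mu]_x complex.Re ((b +i* c) * u x + v x) =
    b * (\int[mu]_x complex.Re (u x)) + (- c) * (\int[mu]_x complex.Im (u x))
    + \int[mu]_x complex.Re (v x).
  have h1 := intZ b _ uR; have h2 := intZ (- c) _ uI.
  have h3 := intD _ _ h1 h2.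
  rewrite -!RintegralZl// -!RintegralD//.
  by apply: eq_Rintegral => x _; case: (u x) (v x) => [? ?] [? ?] /=; ring.
have -> : \int[mu]_x complex.Im ((b +i* c) * u x + v x) =
    b * (\int[mu]_x complex.Im (u x)) + c * (\int[mu]_x complex.Re (u x))
    + \int[mu]_x complex.Im (v x).
  have h1 := intZ b _ uI; have h2 := intZ c _ uR.
  have h3 := intD _ _ h1 h2.
  rewrite -!RintegralZl// -!RintegralD//.
  by apply: eq_Rintegral => x _; case: (u x) (v x) => [? ?] [? ?] /=; ring.
by rewrite mulNr.
Qed.

Fact L2dot_linearl (g : L2) : linear_for *%R (L2dot^~ g).
Proof.
elim/quotW: g => g a; elim/quotW => f; elim/quotW => h.
rewrite -[_ *: _]/(L2scale _ _) L2_scaleE L2_addE !L2dotE.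
rewrite -cintegral_linear//; congr cintegral.
apply/funext => x.
by rewrite -[L2fun_val _ x]/(a * f x + h x) mulrDl mulrA.
Qed.

Fact L2dot_pos (f : L2) : f != 0 -> 0 < L2dot f f.
Proof.
elim/quotW: f => f f0; rewrite L2dotE ltcE /=.
have fE x : f x * (f x)^* = (complex.Re (f x) ^+ 2 + complex.Im (f x) ^+ 2)%:C.
  by case: (f x) => a b /=; congr (_ +i* _) => /=; ring.
apply/andP; split.
  rewrite (@eq_Rintegral _ _ _ mu setT (fun=> 0)) ?Rintegral_cst ?mul0r//.
  by move=> x _; rewrite fE.
have [ffm ffoo] := integrableP _ _ _ (intR f f).
rewrite lt_neqAle Rintegral_ge0 ?andbT; last first.
  by move=> x _; rewrite fE /= addr_ge0 ?sqr_ge0.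
apply: contra f0 => /eqP int0; apply/eqP; rewrite L2_0E; apply/L2_eqP.
have : (\int[mu]_x `|(complex.Re (f x * (f x)^*))%:E| = 0)%E.
  under eq_integral => x _.
    rewrite gee0_abs; last by rewrite lee_fin fE /= addr_ge0 ?sqr_ge0.
    over.
  rewrite -[LHS]fineK; first by congr EFin; exact: esym.
  exact: integrable_fin_num (intR f f).
move/(ae_eq_integral_abs mu measurableT ffm); apply: filterS => x /(_ I) /= [].
rewrite fE /= => /eqP; rewrite paddr_eq0 ?sqr_ge0// !sqrf_eq0.
by case: (f x) => a b /= /andP[/eqP-> /eqP->].
Qed.

Fact L2dot_bilinear : bilinear_for *%R (conjC \; *%R) L2dot.
Proof.
split=> [g|f]; first exact: L2dot_linearl.
move=> a g h; rewrite /= ![L2dot f _]L2dot_herm !expr0 !mul1r L2dot_linearl.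
by rewrite rmorphD rmorphM.
Qed.

HB.instance Definition _ := bilinear_isBilinear.Build R[i] L2 L2 R[i]
  *%R (conjC \; *%R) L2dot L2dot_bilinear.
HB.instance Definition _ := isHermitianSesquilinear.Build R[i] L2
  false conjC L2dot L2dot_herm.
HB.instance Definition _ := isDotProduct.Build R[i] L2 L2dot L2dot_pos.

End L2space.

Arguments L2dot {d T R} mu f g.

Section Operators.
Context {R : realType} {H : lmodType R[i]}.
Variable dot : {dot H for conjC}.
Implicit Types S T B : H -> H.

Definition bounded_operator T :=
  linear T /\ exists M : R, forall f,
    sqrtC (dot (T f) (T f)) <= M%:C * sqrtC (dot f f).

Definition invertible_operator T :=
  exists B, [/\ bounded_operator B, cancel T B & cancel B T].

Definition left_invertible T := exists2 B, bounded_operator B & cancel T B.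

(* Meaningful when T is bijective. *)
Definition inverse_operator T : H -> H := fun g => xget 0 [set f | T f = g].

(* adjoint T g is the h such that <T f, g> = <f, h> for all f; there is at most
   one such h, and there is one when T is bounded and H is complete. *)
Definition adjoint T : H -> H :=
  fun g => xget 0 [set h | forall f, dot (T f) g = dot f h].

Definition cauchy_dual T : H -> H := T \o inverse_operator (adjoint T \o T).

Definition point_spectrum T : set R[i] :=
  [set z | exists2 f : H, f != 0 & T f = z *: f].

Definition spectrum T : set R[i] :=
  [set z | ~ invertible_operator (fun f => z *: f - T f)].

(* Extended-real valued, so that the inverse of a zero radius is +oo. *)
Definition spectral_radius T : \bar R :=
  ereal_sup [set (Normc.normc z)%:E | z in spectrum T].

End Operators.

Section WeightedTranslation.
Context {R : realType}.
Implicit Types (phi : R -> R) (t : R).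

(* Functions on [0, +oo[ are represented by functions on R, whose values on
   ]-oo, 0[ are irrelevant since this measure does not charge that half-line.
   The sigma-algebra is the Borel one: every Lebesgue measurable function is
   almost everywhere equal to a Borel one, so the L2 classes are the same. *)
Definition lebesgue_Rplus : {measure set (measurableTypeR R) -> \bar R} :=
  mrestr lebesgue_measure (measurable_itv `[0 : R, +oo[).

Definition weight phi t (x : R) : R :=
  if t <= x then sqrtr (phi x / phi (x - t)) else 0.

Definition is_symbol phi :=
  [/\ {within `[0, +oo[, continuous phi},
      forall x, 0 <= x -> 0 < phi x &
      forall t, 0 <= t ->
        (ess_sup lebesgue_Rplus (fun x => `|weight phi t x|%:E) < +oo)%E].

Definition wtranslation phi t (f : L2 lebesgue_Rplus) : L2 lebesgue_Rplus :=
  L2class lebesgue_Rplus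
    (fun x => if t <= x
              then (sqrtr (phi x / phi (x - t)))%:C * repr f (x - t) else 0).

End WeightedTranslation.

(* Main.v *)
(* Every x >= 0 is uniquely y + k t with 0 <= y < t, and along each fibre {y + k t}
   the operator S_t is a weighted unilateral shift, with adjoint A the weighted
   backward shift (A f)(x) = sqrt (phi (x + t) / phi x) f (x + t); the operator L_t
   is the same backward shift for the symbol 1/phi.

   (1) A solution of S_t f = z f vanishes on [0, t[, hence on every [0, n t[.

   The key estimate: if w - A is bounded below, with |f|^2 <= K |(w - A) f|^2,
   testing on f (y + j t) = w^j phi(y + j t)^(-1/2) for j <= n and y in a short
   interval J (and f = 0 elsewhere) makes the right-hand side live on J + n t only.
   Shrinking J gives p_0 + ... + p_n <= C p_n for p_j = |w|^(2j) / phi (y + j t) and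
   C = K |w|^2, so p grows geometrically.

   (2) If 1/z is not in the spectrum of L_t, the estimate for 1/phi and w = 1/z
   shows that h (y + k t) = z^k phi(y + k t)^(-1/2) is square integrable; it is an
   eigenvector of A for z.

   (3) If z - S_t is invertible then the conjugate of z minus A is bounded below, and
   the estimate shows that the recursion along fibres solving (w - S_t) f = u is
   bounded in L^2 as soon as |w|^2 > (1 - 1/C) |z|^2. So no w with |w| >= |z|, nor
   slightly smaller, lies in the spectrum. *)
From HB Require Import structures.
Require Import Defs.
From mathcomp Require Import all_boot all_order all_algebra.
From mathcomp Require Import all_classical all_reals all_analysis.
From mathcomp Require Import measurable_realfun ess_sup_inf.
From mathcomp Require Import generic_quotient sesquilinear complex ring lra.

Set Implicit Arguments.
Unset Strict Implicit.
Unset Printing Implicit Defensive.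

Import Order.TTheory GRing.Theory Num.Theory Num.Def.
Import numFieldNormedType.Exports.
Local Open Scope classical_set_scope.
Local Open Scope complex_scope.
Local Open Scope ring_scope.

(** * Lebesgue measure on the half-line *)

Section Translation.
Context {R : realType}.
Local Notation mu := (@lebesgue_Rplus R).
Local Notation leb := (@lebesgue_measure R).

Lemma measurable_addr (a : R) :
  measurable_fun setT (fun x : measurableTypeR R => (x + a : measurableTypeR R)).
Proof. exact: measurable_funD. Qed.

Lemma preimage_addr_ocitv (a x y : R) :
  (fun z => z + a) @^-1` `]x, y]%classic = `](x - a), (y - a)]%classic.
Proof.
by apply/seteqP; split => z /=; rewrite !in_itv /= ltrBlDr lerBrDr.
Qed.

(** By uniqueness of Lebesgue measure, the two sides need only be compared on half-open intervals,
    where translation preserves length. *)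
Lemma lebesgue_measure_translation (a : R) (A : set (measurableTypeR R)) :
  measurable A -> leb ((fun x => x + a) @^-1` A) = leb A.
Proof.
move=> mA.
pose f : {mfun measurableTypeR R >-> measurableTypeR R} :=
  HB.pack (fun x : measurableTypeR R => (x + a : measurableTypeR R))
    (isMeasurableFun.Build _ _ _ _ _ (measurable_addr a)).
apply/esym; rewrite -[RHS]/(pushforward leb f A).
apply: lebesgue_measure_unique => // X [[x y] _ <-] /=.
rewrite /pushforward /f /= preimage_addr_ocitv !lebesgue_measure_itv /= !lte_fin.
by rewrite ltrD2r; case: ifP => // _; rewrite -!EFinB; congr EFin; ring.
Qed.

Lemma lebesgue_RplusE (A : set (measurableTypeR R)) :
  mu A = leb (A `&` `[0, +oo[%classic).
Proof. by []. Qed.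

Lemma lebesgue_Rplus_translation (a : R) (A : set (measurableTypeR R)) :
  0 <= a -> measurable A -> A `<=` `[a, +oo[%classic ->
  mu ((fun x => x + a) @^-1` A) = mu A.
Proof.
move=> a0 mA Aa; rewrite !lebesgue_RplusE.
have -> : A `&` `[0, +oo[%classic = A.
  apply/setIidl => x /Aa /=; rewrite !in_itv /= !andbT; exact: le_trans.
rewrite setIidl ?lebesgue_measure_translation//.
by move=> x /Aa /=; rewrite !in_itv /= !andbT lerDr.
Qed.

(** [D] lies beyond [a] so that its translate stays in the half-line: mass moved below 0 would be
    lost, as [mu] does not charge that side. *)
Lemma ge0_integral_translation (a : R) (D : set (measurableTypeR R))
    (f : R -> \bar R) :
  0 <= a -> measurable D -> D `<=` `[a, +oo[%classic ->
  measurable_fun D f -> (forall x, D x -> (0 <= f x)%E) ->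
  (\int[mu]_(x in D) f x = \int[mu]_(x in (fun x => (x + a)%R) @^-1` D) f (x + a)%R)%E.
Proof.
move=> a0 mD Da mf f0.
pose th : {mfun measurableTypeR R >-> measurableTypeR R} :=
  HB.pack (fun x : measurableTypeR R => (x + a : measurableTypeR R))
    (isMeasurableFun.Build _ _ _ _ _ (measurable_addr a)).
transitivity (\int[pushforward mu th]_(x in D) f x)%E; last first.
  by rewrite ge0_integral_pushforward// => x /[!inE]; exact: f0.
apply: eq_measure_integral => A mA AD.
rewrite /= /pushforward lebesgue_Rplus_translation//; exact: subset_trans Da.
Qed.

Lemma lebesgue_Rplus_neg : mu `]-oo, 0[%classic = 0.
Proof.
rewrite lebesgue_RplusE.
suff -> : `]-oo, 0[%classic `&` `[0, +oo[%classic = set0 :> set R by rewrite measure0.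
apply/seteqP; split => // x /=; rewrite !in_itv /= andbT => -[].
by rewrite ltNge => /negbTE ->.
Qed.

Lemma ae_Rplus_ge0 : {ae mu, forall x, 0 <= x}.
Proof.
exists `]-oo, 0[%classic; split => //=; first exact: lebesgue_Rplus_neg.
by move=> x /=; rewrite in_itv /= ltNge => /negP.
Qed.

#[export] Instance ae_Rplus_filter : Filter (almost_everywhere mu).
Proof. exact: ae_filter_ringOfSetsType. Qed.

Lemma ae_Rplus_addr (a : R) (P : R -> Prop) : 0 <= a ->
  {ae mu, forall x, P x} -> {ae mu, forall x, P (x + a)}.
Proof.
move=> a0 [N [mN N0 PN]].
have mN' : measurable (N `&` `[a, +oo[%classic : set (measurableTypeR R)).
  by apply: measurableI => //; exact: measurable_itv.
have : {ae mu, forall x, 0 <= x -> P (x + a)}.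
  exists ((fun x => x + a) @^-1` (N `&` `[a, +oo[%classic)); split.
  - by rewrite -[X in measurable X]setTI; exact: measurable_addr.
  - rewrite lebesgue_Rplus_translation//.
    apply: (subset_measure0 _ _ _ N0) => //; exact: subIsetl.
  - move=> x /= /not_implyP[x0 nP]; split; first exact: PN.
    by rewrite in_itv /= andbT lerDr.
by apply: filterS2 ae_Rplus_ge0 => x x0; apply.
Qed.

(** The restriction [a <= x] matters: below [a] the point [x - a] is negative, where a property true
    almost everywhere for [mu] may fail throughout. *)
Lemma ae_Rplus_subr (a : R) (P : R -> Prop) : 0 <= a ->
  {ae mu, forall x, P x} -> {ae mu, forall x, a <= x -> P (x - a)}.
Proof.
move=> a0 [N [mN N0 PN]].
have mN' : measurable ((fun x => x - a) @^-1` N : set (measurableTypeR R)).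
  by rewrite -[X in measurable X]setTI; exact: measurable_addr.
have mNa : measurable ((fun x => x - a) @^-1` N `&` `[a, +oo[%classic : set (measurableTypeR R)).
  by apply: measurableI => //; exact: measurable_itv.
exists ((fun x => x - a) @^-1` N `&` `[a, +oo[%classic); split => //.
- rewrite -(@lebesgue_Rplus_translation a)//.
  apply: (subset_measure0 _ _ _ N0) => //; last first.
    by move=> x /= []; rewrite addrK.
  by rewrite -[X in measurable X]setTI; exact: measurable_addr.
- move=> x /= /not_implyP[x0 nP]; split; first exact: PN.
  by rewrite in_itv /= andbT.
Qed.

End Translation.

(** * Decomposition of the half-line along the fibres [y + k t] *)

Section Fibres.
Context {R : realType} (t : R) (t0 : 0 < t).
Local Notation mu := (@lebesgue_Rplus R).

(** This is the level of index [k]: it meets every fibre [y + k t], [0 <= y < t], in exactly one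
    point. *)
Definition fibre (k : nat) : set (measurableTypeR R) :=
  `[k%:R * t, k.+1%:R * t[%classic.

Lemma measurable_fibre k : measurable (fibre k).
Proof. exact: measurable_itv. Qed.

Lemma fibreP k x : fibre k x <-> 0 <= x /\ truncn (x / t) = k.
Proof.
rewrite /fibre /= in_itv /= -ler_pdivlMr// -ltr_pdivrMr//; split.
  move=> kx; split; last exact: truncn_def.
  by have /andP[] := kx; move=> /(le_trans (ler0n _ _)); rewrite pmulr_lge0// invr_gt0.
by move=> [x0 <-]; apply: truncn_itv; rewrite divr_ge0// ltW.
Qed.

Lemma bigcup_fibre : \bigcup_k fibre k = `[0, +oo[%classic.
Proof.
apply/seteqP; split=> x /=; rewrite in_itv /= andbT.
  by move=> [k _ /fibreP[]].
by move=> x0; exists (truncn (x / t)) => //; apply/fibreP.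
Qed.

Lemma trivIset_fibre : trivIset setT fibre.
Proof. by move=> i j _ _ [x [/fibreP[_ <-] /fibreP[_ <-]]]. Qed.

Lemma fibre_addr k y : `[0, t[%classic y -> fibre k (y + k%:R * t).
Proof.
rewrite /fibre /= !in_itv /= => /andP[y0 yt].
by rewrite lerDr y0 -natr1 mulrDl mul1r addrC ltrD2l.
Qed.

Lemma preimage_fibre k : (fun x => x + k%:R * t) @^-1` fibre k = `[0, t[%classic.
Proof.
apply/seteqP; split=> x /=; last exact: fibre_addr.
by rewrite /fibre /= !in_itv /= lerDr -natr1 mulrDl mul1r [_ + t]addrC ltrD2r.
Qed.

Lemma ge0_integral_Rplus (f : R -> \bar R) :
  measurable_fun setT f -> (forall x, (0 <= f x)%E) ->
  (\int[mu]_x f x = \int[mu]_(x in `[0%R, +oo[) f x)%E.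
Proof.
move=> mf f0.
have m0 : measurable (`]-oo, 0[%classic : set (measurableTypeR R)) by exact: measurable_itv.
rewrite (@ge0_negligible_integral _ _ _ mu _ `]-oo, 0[%classic)//.
  congr (integral _ _ _); apply/seteqP; split => x /=; rewrite !in_itv /= andbT leNgt.
    by move=> [_ /negP].
  by move/negP.
exact: lebesgue_Rplus_neg.
Qed.

Lemma ge0_integral_fibres (f : R -> \bar R) :
  measurable_fun setT f -> (forall x, (0 <= f x)%E) ->
  (\int[mu]_x f x =
   \int[mu]_(x in `[0%R, t[) \sum_(0 <= k <oo) f (x + k%:R * t)%R)%E.
Proof.
move=> mf f0; rewrite ge0_integral_Rplus// -bigcup_fibre.
rewrite ge0_integral_bigcup//; last 3 first.
- exact: measurable_fibre.
- exact: measurable_funTS.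
- exact: trivIset_fibre.
rewrite integral_nneseries//; last first.
  move=> k; apply/measurable_funTS/(measurableT_comp mf).
  exact: measurable_addr.
apply: eq_eseriesr => k _.
rewrite (@ge0_integral_translation _ (k%:R * t))//.
- by rewrite preimage_fibre.
- by rewrite mulr_ge0// ltW.
- exact: measurable_fibre.
- by move=> x; rewrite /fibre /= !in_itv /= andbT => /andP[].
- exact: measurable_funTS.
Qed.

(** Assembles a function from its levels. Only the values of [F k] on [[0, t[] are read, and the
    value 0 on the negative half-line is invisible to [mu]. *)
Definition glue {V : nmodType} (F : nat -> R -> V) (x : R) : V :=
  if 0 <= x then F (truncn (x / t)) (x - (truncn (x / t))%:R * t) else 0.

Lemma glueE {V : nmodType} (F : nat -> R -> V) k y :
  `[0, t[%classic y -> glue F (y + k%:R * t) = F k y.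
Proof.
move=> /(fibre_addr k)/fibreP[y0 e]; rewrite /glue y0 e; congr F.
by rewrite addrK.
Qed.

Lemma fibre_ex x : 0 <= x -> exists k y, `[0, t[%classic y /\ x = y + k%:R * t.
Proof.
move=> x0; set k := truncn (x / t); exists k, (x - k%:R * t); split; last by rewrite subrK.
have : fibre k x by apply/fibreP.
rewrite /fibre /= !in_itv /= subr_ge0 => /andP[-> /=].
by rewrite -natr1 mulrDl mul1r addrC -ltrBlDr.
Qed.

Lemma measurable_glue (F : nat -> R -> R) :
  (forall k, measurable_fun setT (F k : measurableTypeR R -> R)) ->
  measurable_fun setT (glue F : measurableTypeR R -> R).
Proof.
move=> mF.
have -> : [set: measurableTypeR R] = `]-oo, 0[%classic `|` \bigcup_k fibre k.
  rewrite bigcup_fibre; apply/seteqP; split=> // x _ /=; rewrite !in_itv /= andbT.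
  by case: (ltP x 0) => _; [left|right].
apply/measurable_funU; [exact: measurable_itv| |split].
  by apply: bigcup_measurable => k _; exact: measurable_fibre.
  apply: (eq_measurable_fun (cst 0 : measurableTypeR R -> R)) => //.
  move=> x; rewrite inE /= in_itv /= /glue => x0.
  by rewrite leNgt x0.
apply/measurable_fun_bigcup => k; first exact: measurable_fibre.
apply: (eq_measurable_fun (fun x : measurableTypeR R => F k (x - k%:R * t))) => //.
  by move=> x /[!inE] /fibreP[x0 xk]; rewrite /glue x0 xk.
by apply/measurable_funTS/(measurableT_comp (mF k)); exact: measurable_addr.
Qed.

End Fibres.

(** * From integral inequalities on short intervals to pointwise ones *)

Section Localization.
Context {R : realType}.
Local Notation mu := (@lebesgue_Rplus R).

Lemma lebesgue_Rplus_itv (y e : R) : 0 <= y -> 0 <= e ->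
  mu `[y, (y + e)[%classic = e%:E.
Proof.
move=> y0 e0; rewrite lebesgue_RplusE setIidl.
  rewrite lebesgue_measure_itv /= lte_fin ltrDl; case: ltP => e1.
    by rewrite -EFinB addrC addKr.
  by congr EFin; apply/eqP; rewrite eq_le e0 e1.
by move=> x /=; rewrite !in_itv /= andbT => /andP[/(le_trans y0)].
Qed.

(** This turns an estimate between L2 norms of functions concentrated near [y] into an inequality at
    [y]. If it failed, continuity would keep [F] and [G] apart on a short interval, and so would
    their integrals. *)
Lemma continuous_le_of_integral (F G : R -> R) (y d : R) :
  continuous F -> continuous G -> (forall x : R, 0 <= x -> 0 <= F x) ->
  (forall x : R, 0 <= x -> 0 <= G x) -> 0 <= y -> 0 < d ->
  (forall e : R, 0 < e -> e < d ->
    (\int[mu]_(x in `[y, (y + e)%R[) (F x)%:E <= \int[mu]_(x in `[y, (y + e)%R[) (G x)%:E)%E) ->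
  F y <= G y.
Proof.
move=> cF cG F0 G0 y0 d0 H; rewrite leNgt; apply/negP => GF.
(* Two separating constants, [G < c < b < F] near [y], so that the integrals over an interval of
   length [e] compare as [b e <= c e], which is absurd. *)
pose c := (F y + G y) / 2.
have [c1 c2] : G y < c /\ c < F y by rewrite /c; split; lra.
pose b := (F y + c) / 2.
have [b1 b2] : c < b /\ b < F y by rewrite /b; split; lra.
have : \forall x \near y, b < F x /\ G x < c.
  by apply: filterI; [apply: (cvgr_gt _ (cF y))|apply: (cvgr_lt _ (cG y))].
move=> /nbhs_ballP[r /= r0 Hr].
pose e := Num.min (r / 2) (d / 2).
have e0 : 0 < e by rewrite lt_min !divr_gt0.
have ed : e < d by rewrite gt_min; apply/orP; right; lra.
have er : e < r by rewrite gt_min; apply/orP; left; lra.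
have mI : measurable (`[y, (y + e)[%classic : set (measurableTypeR R)) by exact: measurable_itv.
have HI x : `[y, (y + e)[%classic x -> b < F x /\ G x < c.
  rewrite /= in_itv /= => /andP[yx xe]; apply: Hr.
  rewrite /ball /= ltr_norml; lra.
have I0 x : `[y, (y + e)[%classic x -> 0 <= x.
  by rewrite /= in_itv /= => /andP[/(le_trans y0)].
have mF : measurable_fun `[y, (y + e)[%classic (EFin \o F : measurableTypeR R -> _).
  by apply/measurable_EFinP/measurable_funTS; exact: continuous_measurable_fun.
have mG : measurable_fun `[y, (y + e)[%classic (EFin \o G : measurableTypeR R -> _).
  by apply/measurable_EFinP/measurable_funTS; exact: continuous_measurable_fun.
have cst0 : 0 <= c by apply: le_trans (ltW c1); exact: G0.
have : (\int[mu]_(x in `[y, (y + e)%R[) (cst b%:E) x <=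
    \int[mu]_(x in `[y, (y + e)%R[) (cst c%:E) x)%E.
  apply: (@le_trans _ _ (\int[mu]_(x in `[y, (y + e)%R[) (F x)%:E)%E).
    apply: ge0_le_integral => //.
    - by move=> x _; rewrite lee_fin (le_trans cst0)// ltW.
    - by move=> x /HI[/ltW].
  apply: (le_trans (H _ e0 ed)).
  apply: ge0_le_integral => //.
  - by move=> x /I0 x0; rewrite lee_fin; exact: G0.
  - by move=> x /HI[_ /ltW].
rewrite !integral_cst//.
rewrite lebesgue_Rplus_itv; [|by []|exact: ltW].
by rewrite -!EFinM lee_fin ler_pM2r// leNgt b1.
Qed.

End Localization.

(** * Square integrable complex functions *)

Section SquaredModulus.
Context {R : realType}.
Implicit Types (z w : R[i]).

(** The squared modulus, valued in [R] rather than [R[i]] so that it can be integrated and compared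
    without square roots. *)
Definition sqmod z : R := complex.Re z ^+ 2 + complex.Im z ^+ 2.

Lemma sqmod_ge0 z : 0 <= sqmod z.
Proof. by rewrite addr_ge0 ?sqr_ge0. Qed.

Lemma sqmodM z w : sqmod (z * w) = sqmod z * sqmod w.
Proof. by case: z w => [a b] [c d]; rewrite /sqmod /=; ring. Qed.

Lemma sqmod0 : sqmod 0 = 0.
Proof. by rewrite /sqmod /= expr0n addr0. Qed.

Lemma sqmod1 : sqmod 1 = 1.
Proof. by rewrite /sqmod /= expr0n expr1n addr0. Qed.

Lemma sqmodX z n : sqmod (z ^+ n) = sqmod z ^+ n.
Proof. by elim: n => [|n IH]; rewrite ?sqmod1// !exprS sqmodM IH. Qed.

Lemma sqmod_eq0 z : (sqmod z == 0) = (z == 0).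
Proof. by case: z => a b; rewrite paddr_eq0 ?sqr_ge0// !sqrf_eq0 eq_complex. Qed.

Lemma sqmod_gt0 z : (0 < sqmod z) = (z != 0).
Proof. by rewrite lt_def sqmod_ge0 andbT sqmod_eq0. Qed.

Lemma sqmodV z : sqmod z^-1 = (sqmod z)^-1.
Proof.
have [->|z0] := eqVneq z 0; first by rewrite invr0 sqmod0 invr0.
have sz0 : sqmod z != 0 by rewrite sqmod_eq0.
by apply: (mulfI sz0); rewrite -sqmodM !mulfV// sqmod1.
Qed.

Lemma sqmod_conj z : sqmod z^* = sqmod z.
Proof. by case: z => a b; rewrite /sqmod /= !sqrrN. Qed.

Lemma sqmod_real (a : R) : sqmod a%:C = a ^+ 2.
Proof. by rewrite /sqmod /= expr0n addr0. Qed.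

Lemma mulr_conjE z : z * z^* = (sqmod z)%:C.
Proof. by case: z => a b; rewrite /sqmod; congr (_ +i* _) => /=; ring. Qed.

Lemma conj_realC (a : R) : (a%:C)^* = a%:C :> R[i].
Proof. by apply/eqP; rewrite eq_complex /= oppr0 !eqxx. Qed.

Lemma normc_sqmod z : Normc.normc z = sqrtr (sqmod z).
Proof. by case: z. Qed.

(** A form of Young's inequality, by completing squares. The free [e] lets the coefficient of
    [sqmod w] be as close to 1 as desired, which is what a strict but arbitrarily weak contraction
    can afford. *)
Lemma sqmodD_le (e : R) z w : 0 < e ->
  sqmod (z + w) <= (1 + e^-1) * sqmod z + (1 + e) * sqmod w.
Proof.
move=> e0; case: z w => [a b] [c d]; rewrite /sqmod /= -subr_ge0.
have -> : (1 + e^-1) * (a ^+ 2 + b ^+ 2) + (1 + e) * (c ^+ 2 + d ^+ 2) -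
   ((a + c) ^+ 2 + (b + d) ^+ 2) = e^-1 * (a - e * c) ^+ 2 + e^-1 * (b - e * d) ^+ 2.
  by field; rewrite gt_eqF.
by rewrite addr_ge0// mulr_ge0 ?sqr_ge0// invr_ge0 ltW.
Qed.

End SquaredModulus.

Section ComplexMeasurable.
Context {d : measure_display} {T : measurableType d} {R : realType}.

Definition cmeasurable (f : T -> R[i]) :=
  measurable_fun setT (fun x => complex.Re (f x)) /\
  measurable_fun setT (fun x => complex.Im (f x)).

Lemma cmeasurable_real (f : T -> R) :
  measurable_fun setT f -> cmeasurable (fun x => (f x)%:C).
Proof. by []. Qed.

Lemma cmeasurable_cst (c : R[i]) : cmeasurable (fun=> c).
Proof. by split; exact: measurable_cst. Qed.

Lemma cmeasurableD f g : cmeasurable f -> cmeasurable g ->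
  cmeasurable (fun x => f x + g x).
Proof.
move=> [fr fi] [gr gi]; split.
  apply: eq_measurable_fun (measurable_funD fr gr) => x _ /=.
  by case: (f x) (g x) => [? ?] [? ?].
apply: eq_measurable_fun (measurable_funD fi gi) => x _ /=.
by case: (f x) (g x) => [? ?] [? ?].
Qed.

Lemma cmeasurableM f g : cmeasurable f -> cmeasurable g ->
  cmeasurable (fun x => f x * g x).
Proof.
move=> [fr fi] [gr gi]; split.
  have := measurable_funB (measurable_funM fr gr) (measurable_funM fi gi).
  apply: eq_measurable_fun => x _ /=.
  by case: (f x) (g x) => [? ?] [? ?].
have := measurable_funD (measurable_funM fr gi) (measurable_funM fi gr).
apply: eq_measurable_fun => x _ /=.
by case: (f x) (g x) => [? ?] [? ?].
Qed.

Lemma cmeasurable_conj f : cmeasurable f -> cmeasurable (fun x => (f x)^*).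
Proof.
move=> [fr fi]; split.
  by apply: eq_measurable_fun fr => x _; case: (f x).
by apply: eq_measurable_fun (measurable_funN fi) => x _ /=; case: (f x).
Qed.

Lemma measurable_sqmod f : cmeasurable f -> measurable_fun setT (fun x => sqmod (f x)).
Proof. by move=> [fr fi]; apply: measurable_funD; exact: measurable_funX. Qed.

End ComplexMeasurable.

Section L2Theory.
Context {d : measure_display} {T : measurableType d} {R : realType}.
Variable mu : {measure set T -> \bar R}.
Implicit Types (f g : T -> R[i]) (F G : L2 mu).

Definition sqint f : \bar R := (\int[mu]_x (sqmod (f x))%:E)%E.

Lemma Lfun2P (u : T -> R) : u \in Lfun mu 2%:E <->
  measurable_fun setT u /\ (\int[mu]_x (u x ^+ 2)%:E < +oo)%E.
Proof.
split=> [uL|[mu_ fin]].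
  have /integrableP[_ h] := Lfun2_integrable_sqr uL.
  have mu_ : measurable_fun setT u by move: uL; rewrite inE => /andP[]; rewrite inE.
  split => //; apply: le_lt_trans h.
  rewrite le_eqVlt; apply/orP; left; apply/eqP/eq_integral => x _ /=.
  by rewrite ger0_norm ?sqr_ge0.
rewrite inE; apply/andP; split; rewrite inE//=.
rewrite /finite_norm unlock /=; apply: poweR_lty.
suff <- : (\int[mu]_x (u x ^+ 2)%:E = \int[mu]_x (`|(u x)%:E| `^ 2))%E by [].
apply: eq_integral => x _ /=.
by rewrite powR_mulrn// real_normK// num_real.
Qed.

Lemma L2predP f : f \in L2pred mu <-> cmeasurable f /\ (sqint f < +oo)%E.
Proof.
rewrite inE; split=> [/andP[/Lfun2P[mr hr] /Lfun2P[mi hi]]|[[mr mi] h]].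
  split => //; rewrite /sqint.
  under eq_integral do rewrite EFinD.
  rewrite ge0_integralD//; first exact: lte_add_pinfty.
  - by move=> x _; rewrite lee_fin sqr_ge0.
  - exact/measurable_EFinP/measurable_funX.
  - by move=> x _; rewrite lee_fin sqr_ge0.
  - exact/measurable_EFinP/measurable_funX.
have mE (u : T -> R) : measurable_fun setT u -> (forall x, u x ^+ 2 <= sqmod (f x)) ->
    u \in Lfun mu 2%:E.
  move=> m_u ule; apply/Lfun2P; split => //; apply: le_lt_trans h.
  apply: ge0_le_integral => //.
  - by move=> x _; rewrite lee_fin sqr_ge0.
  - exact/measurable_EFinP/measurable_funX.
  - by apply/measurable_EFinP/measurable_sqmod.
  - by move=> x _; rewrite lee_fin; exact: ule.
by apply/andP; split; apply: mE => // x; rewrite /sqmod ?lerDl ?lerDr sqr_ge0.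
Qed.

Lemma cmeasurable_repr F : cmeasurable (repr F).
Proof. by have /L2predP[] := valP (repr F). Qed.

Lemma sqint_repr_lty F : (sqint (repr F) < +oo)%E.
Proof. by have /L2predP[] := valP (repr F). Qed.

Lemma sqint_ge0 f : (0 <= sqint f)%E.
Proof. by apply: integral_ge0 => x _; rewrite lee_fin sqmod_ge0. Qed.

Lemma sqint_ae f g : cmeasurable f -> cmeasurable g ->
  {ae mu, forall x, f x = g x} -> sqint f = sqint g.
Proof.
move=> mf mg fg; apply: ae_eq_integral => //.
- exact/measurable_EFinP/measurable_sqmod.
- exact/measurable_EFinP/measurable_sqmod.
- by apply: filterS fg => x fg _; rewrite fg.
Qed.

Lemma L2class_repr f : f \in L2pred mu ->
  {ae mu, forall x, repr (L2class mu f) x = f x}.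
Proof.
move=> fL; have := L2_reprE (mu := mu) (insubd 0 f).
by apply: filterS => x; rewrite /L2class => ->; rewrite /insubd insubT.
Qed.

Lemma L2_ext F G : {ae mu, forall x, repr F x = repr G x} -> F = G.
Proof. by move=> h; rewrite -[F]reprK -[G]reprK; exact/L2_eqP. Qed.

Lemma L2_reprD F G : {ae mu, forall x, repr (F + G) x = repr F x + repr G x}.
Proof.
rewrite -[F in F + G]reprK -[G in X in repr X]reprK L2_addE.
exact: L2_reprE.
Qed.

Lemma L2_reprZ (a : R[i]) F : {ae mu, forall x, repr (a *: F) x = a * repr F x}.
Proof.
rewrite -[F in a *: F]reprK -[_ *: _]/(L2scale _ _) L2_scaleE.
exact: L2_reprE.
Qed.

Lemma L2_reprP (a : R[i]) F G :
  {ae mu, forall x, repr (a *: F + G) x = a * repr F x + repr G x}.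
Proof.
by apply: filterS2 (L2_reprD (a *: F) G) (L2_reprZ a F) => x -> ->.
Qed.

Lemma L2_repr0 : {ae mu, forall x, repr (0 : L2 mu) x = 0}.
Proof. by rewrite L2_0E; exact: L2_reprE. Qed.

Lemma L2_reprB F G : {ae mu, forall x, repr (F - G) x = repr F x - repr G x}.
Proof.
rewrite -scaleN1r; apply: filterS2 (L2_reprD F (-1 *: G)) (L2_reprZ (-1) G).
by move=> x -> ->; rewrite mulN1r.
Qed.

Definition sqnorm F : R := fine (sqint (repr F)).

Lemma sqnormE F : (sqnorm F)%:E = sqint (repr F).
Proof. by rewrite fineK// ge0_fin_numE ?sqint_ge0// sqint_repr_lty. Qed.

Lemma sqnorm_ge0 F : 0 <= sqnorm F.
Proof. by rewrite -lee_fin sqnormE sqint_ge0. Qed.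

Lemma L2dotxx F : L2dot mu F F = (sqnorm F)%:C.
Proof.
rewrite /L2dot /cintegral; congr (_ +i* _).
  by congr fine; apply: eq_integral => x _; rewrite mulr_conjE.
rewrite (@eq_Rintegral _ _ _ mu setT (fun=> 0)) ?Rintegral_cst ?mul0r//.
by move=> x _; rewrite mulr_conjE.
Qed.

Lemma sqnorm_eq0 F : sqnorm F = 0 -> F = 0.
Proof.
move=> F0; apply/eqP/negP => /negP /L2dot_pos.
by rewrite L2dotxx F0 ltxx.
Qed.

(** Squared norms are integrals of [sqmod], so later estimates use this form; the two constants
    correspond by squaring. *)
Lemma bounded_operatorP (A : L2 mu -> L2 mu) :
  bounded_operator (@L2dot d T R mu) A <->
  linear A /\ exists2 K : R, 0 < K & forall F, sqnorm (A F) <= K * sqnorm F.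
Proof.
have sC (a : R) : 0 <= a -> sqrtC a%:C = (sqrtr a)%:C.
  move=> a0; rewrite -{1}(sqr_sqrtr a0) rmorphXn /= sqrCK//.
  by rewrite lecR sqrtr_ge0.
pose dt : {dot L2 mu for conjC} := @L2dot d T R mu.
have dE G : dt G G = (sqnorm G)%:C := L2dotxx G.
rewrite /bounded_operator; split=> -[lA].
  (* The added 1 makes the constant positive even when [M] is zero. *)
  move=> [M HM]; split => //; exists (M ^+ 2 + 1); first by rewrite ltr_wpDl ?sqr_ge0.
  move=> F; have := HM F; rewrite !dE !sC ?sqnorm_ge0// -rmorphM lecR => h.
  have : sqrtr (sqnorm (A F)) ^+ 2 <= (M * sqrtr (sqnorm F)) ^+ 2.
    by rewrite ler_pXn2r// nnegrE ?sqrtr_ge0// (le_trans _ h)// sqrtr_ge0.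
  rewrite exprMn !sqr_sqrtr ?sqnorm_ge0// => /le_trans; apply.
  by rewrite ler_wpM2r ?sqnorm_ge0// lerDl.
move=> [K K0 HK]; split => //; exists (sqrtr K) => F.
rewrite !dE !sC ?sqnorm_ge0// -rmorphM lecR -sqrtrM ?(ltW K0)//.
by apply: ler_wsqrtr.
Qed.

End L2Theory.

(** * Weighted shifts *)

Section AbstractAdjoint.
Context {R : realType} {H : lmodType R[i]}.
Variable dot : {dot H for conjC}.

Lemma dot_right_inj (h k : H) : (forall f, dot f h = dot f k) -> h = k.
Proof.
move=> hk; apply/eqP; rewrite -subr_eq0; apply/negP => /negP /(@neq0_dnorm_gt0 _ _ conjC dot).
by rewrite linearBr /= hk subrr ltxx.
Qed.

(** The set in which [adjoint] chooses contains [A g], and nondegeneracy of the form leaves no other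
    element to choose. *)
Lemma adjoint_unique (T A : H -> H) :
  (forall f g, dot (T f) g = dot f (A g)) -> adjoint dot T = A.
Proof.
move=> TA; apply/funext => g; rewrite /adjoint.
have /(xgetI 0) hx : [set h | forall f, dot (T f) g = dot f h] (A g).
  by move=> f; exact: TA.
 apply: dot_right_inj => f.
by rewrite -hx TA.
Qed.

Lemma inverse_operator_unique (T : H -> H) (f g : H) :
  injective T -> T f = g -> inverse_operator T g = f.
Proof.
move=> iT Tf; apply: iT; rewrite Tf.
have : [set h | T h = g] f by [].
by move=> /(xgetI 0).
Qed.

End AbstractAdjoint.

(** * The substitution of [x + t] for [x] in integrals *)

Section ShiftIntegral.
Context {R : realType} (t : R) (t0 : 0 < t).
Local Notation mu := (@lebesgue_Rplus R).

Let geT : measurable_fun setT (fun x : measurableTypeR R => t <= x).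
Proof. exact: measurable_fun_ler. Qed.

Lemma ge0_integral_shift (u : R -> \bar R) :
  measurable_fun setT (u : measurableTypeR R -> \bar R) -> (forall x, (0 <= u x)%E) ->
  (\int[mu]_x (if (t <= x)%R then u x else 0) = \int[mu]_x u (x + t)%R)%E.
Proof.
move=> mu_ u0.
transitivity (\int[mu]_(x in `[t, +oo[) u x)%E.
  rewrite [RHS]integral_mkcond; apply: eq_integral => x _.
  by rewrite patchE mem_setE in_itv /= andbT.
rewrite (@ge0_integral_translation _ t)//.
- rewrite [RHS]ge0_integral_Rplus//; last first.
    by apply: (measurableT_comp mu_); exact: measurable_addr.
  congr integral; apply/seteqP; split => x /=; by rewrite !in_itv /= !andbT lerDr.
- exact: ltW.
- exact: measurable_funTS.
Qed.

Lemma integral_shift (v : R -> R) : measurable_fun setT (v : measurableTypeR R -> R) ->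
  (\int[mu]_x (if t <= x then v x else 0) = \int[mu]_x v (x + t))%R.
Proof.
move=> mv; rewrite /Rintegral; congr fine.
rewrite integralE [RHS]integralE.
have mE : measurable_fun setT (EFin \o v : measurableTypeR R -> _) by exact/measurable_EFinP.
congr (_ - _)%E.
  transitivity (\int[mu]_x (if (t <= x)%R then (EFin \o v)^\+ x else 0))%E.
    by apply: eq_integral => x _; rewrite !funeposE /=; case: ifP => //; rewrite maxxx.
  rewrite ge0_integral_shift//; last exact: measurable_funepos.
  by apply: eq_integral => x _; rewrite !funeposE.
transitivity (\int[mu]_x (if (t <= x)%R then (EFin \o v)^\- x else 0))%E.
  by apply: eq_integral => x _; rewrite !funenegE /=; case: ifP => //; rewrite -?EFinN oppr0 maxxx.
rewrite ge0_integral_shift//; last exact: measurable_funeneg.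
by apply: eq_integral => x _; rewrite !funenegE.
Qed.

Lemma cintegral_shift (h : R -> R[i]) : cmeasurable (h : measurableTypeR R -> _) ->
  cintegral mu (fun x => if t <= x then h x else 0) = cintegral mu (fun x => h (x + t)).
Proof.
move=> [hr hi]; rewrite /cintegral -(integral_shift hr) -(integral_shift hi).
by congr (_ +i* _); apply: eq_Rintegral => x _; case: ifP.
Qed.

Lemma sqint_shift (h : R -> R[i]) : cmeasurable (h : measurableTypeR R -> _) ->
  sqint mu (fun x => if t <= x then h x else 0) = sqint mu (fun x => h (x + t)).
Proof.
move=> mh; rewrite /sqint -(@ge0_integral_shift (fun x => (sqmod (h x))%:E)).
- by apply: eq_integral => x _; case: ifP => //; rewrite sqmod0.
- by apply/measurable_EFinP/measurable_sqmod.
- by move=> x; rewrite lee_fin sqmod_ge0.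
Qed.

Lemma sqint_le (K : R) (f g : R -> R[i]) : 0 <= K ->
  cmeasurable (f : measurableTypeR R -> _) -> cmeasurable (g : measurableTypeR R -> _) ->
  (forall x, 0 <= x -> sqmod (f x) <= K * sqmod (g x)) ->
  (sqint mu f <= K%:E * sqint mu g)%E.
Proof.
move=> K0 mf mg fg.
have mf2 : measurable_fun setT (fun x : measurableTypeR R => (sqmod (f x))%:E).
  by apply/measurable_EFinP/measurable_sqmod.
have mg2 : measurable_fun setT (fun x : measurableTypeR R => (sqmod (g x))%:E).
  by apply/measurable_EFinP/measurable_sqmod.
rewrite /sqint -ge0_integralZl//; last by move=> x _; rewrite lee_fin sqmod_ge0.
rewrite ge0_integral_Rplus//; last by move=> x; rewrite lee_fin sqmod_ge0.
rewrite ge0_integral_Rplus//; last 2 first.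
- exact: measurable_funeM.
- by move=> x; rewrite -EFinM lee_fin mulr_ge0// sqmod_ge0.
apply: ge0_le_integral => //.
- by move=> x _; rewrite lee_fin sqmod_ge0.
- exact: measurable_funTS.
- by apply: measurable_funTS; exact: measurable_funeM.
- by move=> x /=; rewrite in_itv /= andbT => /fg; rewrite -EFinM lee_fin.
Qed.

Lemma cintegral_ae (f g : R -> R[i]) :
  cmeasurable (f : measurableTypeR R -> _) -> cmeasurable (g : measurableTypeR R -> _) ->
  {ae mu, forall x, f x = g x} -> cintegral mu f = cintegral mu g.
Proof.
move=> [fr fi] [gr gi] fg.
congr (_ +i* _); congr fine; apply: ae_eq_integral => //; try exact/measurable_EFinP.
  by apply: filterS fg => x -> _.
by apply: filterS fg => x -> _.
Qed.

Lemma cmeasurable_addr (h : R -> R[i]) (a : R) : cmeasurable (h : measurableTypeR R -> _) ->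
  cmeasurable ((fun x => h (x + a)) : measurableTypeR R -> _).
Proof.
move=> [hr hi].
by split; [apply: (measurableT_comp hr)|apply: (measurableT_comp hi)]; exact: measurable_addr.
Qed.

Lemma cmeasurable_if (h : R -> R[i]) : cmeasurable (h : measurableTypeR R -> _) ->
  cmeasurable ((fun x => if t <= x then h x else 0) : measurableTypeR R -> _).
Proof.
move=> [hr hi]; split.
  apply: (eq_measurable_fun (fun x : measurableTypeR R => if t <= x then complex.Re (h x) else 0)).
    by move=> x _; case: ifP.
  by apply: measurable_fun_ifT.
apply: (eq_measurable_fun (fun x : measurableTypeR R => if t <= x then complex.Im (h x) else 0)).
  by move=> x _; case: ifP.
by apply: measurable_fun_ifT.
Qed.

End ShiftIntegral.

Section WeightedShifts.
Context {R : realType} (t : R) (t0 : 0 < t).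
Local Notation mu := (@lebesgue_Rplus R).
Implicit Types (psi : R -> R) (f g : R -> R[i]) (F G : L2 mu).

(** The last clause bounds the squared weights of the translation by [t]. Asked of [1 / psi], it
    bounds the weights of [psi] from below, which is how left invertibility enters. *)
Definition admissible psi := [/\ continuous psi, (forall x, 0 < psi x) &
  exists2 K : R, 0 < K & forall x, 0 <= x -> psi (x + t) <= K * psi x].

(** [fwd] and [bwd] are the translation and its adjoint on functions; the operators on classes agree
    with them only almost everywhere. *)
Definition fwd psi f x : R[i] :=
  if t <= x then (sqrtr (psi x / psi (x - t)))%:C * f (x - t) else 0.

Definition bwd psi f x : R[i] := (sqrtr (psi (x + t) / psi x))%:C * f (x + t).

Definition bshift psi F : L2 mu := L2class mu (bwd psi (repr F)).

Section Admissible.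
Variables (psi : R -> R) (adm : admissible psi).

Let cpsi : continuous psi. Proof. by case: adm. Qed.
Let psi0 x : 0 < psi x. Proof. by case: adm. Qed.

Lemma psi_ratio_ge0 x y : 0 <= psi x / psi y.
Proof. by rewrite divr_ge0// ltW. Qed.

Lemma measurable_psi : measurable_fun setT (psi : measurableTypeR R -> R).
Proof. exact: continuous_measurable_fun. Qed.

Lemma continuous_psiV : continuous (fun x => (psi x)^-1).
Proof. by move=> x; apply: cvgV; [rewrite gt_eqF|exact: cpsi]. Qed.

Lemma measurable_sqrt_ratio (a b : R) :
  measurable_fun setT ((fun x => sqrtr (psi (x + a) / psi (x + b))) : measurableTypeR R -> R).
Proof.
have mshift (u : R -> R) c : continuous u ->
    measurable_fun setT ((fun x => u (x + c)) : measurableTypeR R -> R).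
  move=> cu.
  exact: (measurableT_comp (continuous_measurable_fun cu) (measurable_addr c)).
apply: (measurableT_comp (continuous_measurable_fun (@sqrt_continuous R))).
apply: measurable_funM; first exact: mshift.
exact: (mshift (fun x => (psi x)^-1) b continuous_psiV).
Qed.

Lemma cmeasurable_weight_subr f : cmeasurable (f : measurableTypeR R -> _) ->
  cmeasurable ((fun x => (sqrtr (psi x / psi (x - t)))%:C * f (x - t)) :
    measurableTypeR R -> _).
Proof.
move=> mf; apply: cmeasurableM; last exact: (@cmeasurable_addr _ f).
apply: cmeasurable_real.
have := measurable_sqrt_ratio 0 (- t).
by under eq_fun do rewrite addr0.
Qed.

Lemma cmeasurable_fwd f : cmeasurable (f : measurableTypeR R -> _) ->
  cmeasurable (fwd psi f : measurableTypeR R -> _).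
Proof.
by move=> mf; apply: cmeasurable_if; exact: cmeasurable_weight_subr.
Qed.

Lemma cmeasurable_bwd f : cmeasurable (f : measurableTypeR R -> _) ->
  cmeasurable (bwd psi f : measurableTypeR R -> _).
Proof.
move=> mf; apply: cmeasurableM; last exact: cmeasurable_addr.
apply: cmeasurable_real.
have := measurable_sqrt_ratio t 0.
by under eq_fun do rewrite addr0.
Qed.

Lemma sqmod_ratio x y z : sqmod ((sqrtr (psi x / psi y))%:C * z) = psi x / psi y * sqmod z.
Proof. by rewrite sqmodM sqmod_real sqr_sqrtr ?psi_ratio_ge0. Qed.

(** After the substitution of [x + t] for [x] the squared weight is [psi (x + t) / psi x], which is
    at most [K] on the half-line. *)
Lemma fwd_L2 f : f \in L2pred mu -> fwd psi f \in L2pred mu.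
Proof.
move=> /(@L2predP _ _ _ mu)[mf fL]; apply/(@L2predP _ _ _ mu); split; first exact: cmeasurable_fwd.
have [_ _ [K K0 HK]] := adm.
apply: (@le_lt_trans _ _ (K%:E * sqint mu f)%E); last first.
  by rewrite lte_mul_pinfty// lee_fin ltW.
have mh := cmeasurable_weight_subr mf.
rewrite /fwd sqint_shift//.
apply: sqint_le => //; first exact: ltW.
  exact: (cmeasurable_addr t mh).
move=> x x0; rewrite addrK sqmod_ratio ler_wpM2r ?sqmod_ge0//.
by rewrite ler_pdivrMr// HK.
Qed.

Lemma bwd_L2 f : f \in L2pred mu -> bwd psi f \in L2pred mu.
Proof.
move=> /(@L2predP _ _ _ mu)[mf fL]; apply/(@L2predP _ _ _ mu); split; first exact: cmeasurable_bwd.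
have [_ _ [K K0 HK]] := adm.
apply: (@le_lt_trans _ _ (K%:E * sqint mu f)%E); last first.
  by rewrite lte_mul_pinfty// lee_fin ltW.
have h1 : (sqint mu (bwd psi f) <= K%:E * sqint mu (fun x => f (x + t)%R))%E.
  apply: sqint_le; [exact: ltW|exact: cmeasurable_bwd|exact: cmeasurable_addr|].
  move=> x x0; rewrite sqmod_ratio ler_wpM2r ?sqmod_ge0//.
  by rewrite ler_pdivrMr// HK.
apply: (le_trans h1).
rewrite lee_pmul2l//.
rewrite -sqint_shift// -[leRHS]mul1e; apply: sqint_le => //; first exact: cmeasurable_if.
by move=> x _; rewrite mul1r; case: ifP => // _; rewrite sqmod0 sqmod_ge0.
Qed.

Lemma wtranslation_repr F :
  {ae mu, forall x, repr (wtranslation psi t F) x = fwd psi (repr F) x}.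
Proof. by apply: L2class_repr; apply: fwd_L2; exact: valP. Qed.

Lemma bshift_repr F : {ae mu, forall x, repr (bshift psi F) x = bwd psi (repr F) x}.
Proof. by apply: L2class_repr; apply: bwd_L2; exact: valP. Qed.

Lemma wtranslation_linear : linear (wtranslation psi t : L2 mu -> L2 mu).
Proof.
move=> a F G; apply: L2_ext.
have e1 := wtranslation_repr (a *: F + G).
have e2 := ae_Rplus_subr (ltW t0) (L2_reprP a F G).
have e3 := L2_reprP a (wtranslation psi t F) (wtranslation psi t G).
have e4 := wtranslation_repr F; have e5 := wtranslation_repr G.
apply: filterS2 (filterI e1 e2) (filterI e3 (filterI e4 e5)) => x.
move=> [-> E2] [-> [-> ->]]; rewrite /fwd; case: ifP => [tx|_].
  by rewrite E2//; ring.
by rewrite mulr0 addr0.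
Qed.

(** The substitution of [x + t] for [x] moves the shift, together with its real weight, from the
    first factor to the second. *)
Lemma wtranslation_adj F G :
  L2dot mu (wtranslation psi t F) G = L2dot mu F (bshift psi G).
Proof.
have mF := cmeasurable_repr F; have mG := cmeasurable_repr G.
pose h x := (sqrtr (psi x / psi (x - t)))%:C * repr F (x - t) * (repr G x)^*.
have mh : cmeasurable (h : measurableTypeR R -> _).
  apply: cmeasurableM; last exact: cmeasurable_conj.
  exact: cmeasurable_weight_subr.
have -> : L2dot mu (wtranslation psi t F) G =
    cintegral mu (fun x => if t <= x then h x else 0).
  apply: cintegral_ae.
  - apply: cmeasurableM; first exact: cmeasurable_repr.
    exact: cmeasurable_conj.
  - exact: cmeasurable_if.
  - apply: filterS (wtranslation_repr F) => x ->.
    by rewrite /fwd /h; case: ifP => // _; rewrite mul0r.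
rewrite cintegral_shift//; apply: cintegral_ae.
- exact: (@cmeasurable_addr _ h).
- apply: cmeasurableM => //; apply: cmeasurable_conj; exact: cmeasurable_repr.
- apply: filterS (bshift_repr G) => x ->.
  rewrite /bwd /h addrK rmorphM /= conj_realC; ring.
Qed.

Lemma adjoint_wtranslation :
  adjoint (@L2dot _ _ R mu) (wtranslation psi t) = bshift psi.
Proof. by apply: adjoint_unique => F G; exact: wtranslation_adj. Qed.

End Admissible.

Section CauchyDual.
Variable psi : R -> R.
Local Notation psiV := (fun x => (psi x)^-1).
Hypotheses (adm : admissible psi) (admV : admissible psiV).

Let psi0 x : 0 < psi x. Proof. by case: adm. Qed.

(** The two shifts cancel and the weights multiply: the adjoint composed with the translation is a
    multiplication operator, inverted by multiplying by the reciprocal. *)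
Lemma bshift_wtranslation_repr F : {ae mu, forall x,
  repr (bshift psi (wtranslation psi t F)) x = (psi (x + t) / psi x)%:C * repr F x}.
Proof.
have e1 := bshift_repr adm (wtranslation psi t F).
have e2 := ae_Rplus_addr (ltW t0) (wtranslation_repr adm F).
apply: filterS2 ae_Rplus_ge0 (filterI e1 e2) => x x0 [-> E2].
rewrite /bwd E2 /fwd lerDr x0 addrK mulrA -rmorphM /= -expr2 sqr_sqrtr//.
by rewrite divr_ge0// ltW.
Qed.

Lemma bshift_wtranslation_inj : injective (bshift psi \o wtranslation psi t : L2 mu -> L2 mu).
Proof.
move=> F G /= FG; apply: L2_ext.
apply: filterS2 (bshift_wtranslation_repr F) (bshift_wtranslation_repr G) => x.
rewrite FG => -> /mulfI; apply.
by rewrite gt_eqF// ltcR divr_gt0.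
Qed.

(** The inverse of the multiplication operator contributes the factor [psi (x - t) / psi x], which
    turns the weight [sqrt (psi x / psi (x - t))] into its reciprocal. *)
Lemma cauchy_dual_wtranslation :
  cauchy_dual (@L2dot _ _ R mu) (wtranslation psi t) = wtranslation psiV t.
Proof.
apply/funext => F; rewrite /cauchy_dual adjoint_wtranslation//=.
(* The candidate for the preimage of [F]; it is square integrable because [1 / psi] is
   admissible. *)
pose m := L2class mu (fun x => (psi x / psi (x + t))%:C * repr F x).
have mE : {ae mu, forall x, repr m x = (psi x / psi (x + t))%:C * repr F x}.
  apply: L2class_repr; apply/L2predP.
  have mm : cmeasurable ((fun x => (psi x / psi (x + t))%:C * repr F x) : measurableTypeR R -> _).
    apply: cmeasurableM; last exact: cmeasurable_repr.
    apply: cmeasurable_real; apply: measurable_funM; first exact: measurable_psi.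
    exact: (measurableT_comp (measurable_psi admV) (measurable_addr t)).
  split => //.
  have [_ _ [K K0 HK]] := admV.
  apply: (@le_lt_trans _ _ ((K ^+ 2)%:E * sqint mu (repr F))%E); last first.
    by rewrite lte_mul_pinfty// ?lee_fin ?sqr_ge0// sqint_repr_lty.
  apply: sqint_le => //; [exact: sqr_ge0|exact: cmeasurable_repr|].
  move=> x x0; rewrite sqmodM sqmod_real ler_wpM2r ?sqmod_ge0//.
  rewrite ler_pXn2r// ?nnegrE ?divr_ge0// ?(ltW (psi0 _)) ?(ltW K0)//.
  by rewrite mulrC -ler_pdivlMr// HK.
rewrite (@inverse_operator_unique _ _ _ m); last 2 first.
- exact: bshift_wtranslation_inj.
- apply: L2_ext; apply: filterS2 (bshift_wtranslation_repr m) mE => x -> ->.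
  rewrite mulrA -rmorphM /=.
  have -> : psi (x + t) / psi x * (psi x / psi (x + t)) = 1.
    by field; rewrite !gt_eqF.
  by rewrite mul1r.
apply: L2_ext; have e1 := wtranslation_repr adm m.
have e2 := ae_Rplus_subr (ltW t0) mE; have e3 := wtranslation_repr admV F.
apply: filterS2 e1 (filterI e2 e3) => x -> [E2 ->]; rewrite /fwd.
case: ifP => // tx; rewrite E2// subrK mulrA -rmorphM /= invrK; congr (_%:C * _).
set a := psi x; set b := psi (x - t).
have [a0 b0] : 0 < a /\ 0 < b by rewrite !psi0.
(* Both sides of [sqrt (a / b) * (b / a) = sqrt (b / a)] are nonnegative, so squares are
   compared. *)
apply: (@pexpIrn _ 2) => //.
- by rewrite nnegrE mulr_ge0 ?sqrtr_ge0// divr_ge0// ltW.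
- by rewrite nnegrE sqrtr_ge0.
- rewrite exprMn !sqr_sqrtr ?divr_ge0 ?mulr_ge0 ?invr_ge0// ?ltW//.
  by field; rewrite !gt_eqF.
Qed.

End CauchyDual.

End WeightedShifts.

(** * The key estimate *)

Lemma nneseries_le_sum {R : realType} (a : nat -> R) (b : \bar R) :
  (forall k, 0 <= a k) -> (forall n, ((\sum_(k < n) a k)%:E <= b)%E) ->
  (\sum_(0 <= k <oo) (a k)%:E <= b)%E.
Proof.
move=> a0 ab; apply: lime_le.
  by apply: is_cvg_nneseries => n _ _; rewrite lee_fin.
by apply: nearW => n; rewrite big_mkord sumEFin.
Qed.

Lemma nneseries_finite {R : realType} (a : nat -> R) n :
  (forall k, 0 <= a k) -> (forall k, (n <= k)%N -> a k = 0) ->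
  (\sum_(0 <= k <oo) (a k)%:E)%E = (\sum_(k < n) a k)%:E.
Proof.
move=> a0 an; rewrite (@nneseries_split _ _ 0 n).
  by rewrite add0n eseries0 ?adde0 ?big_mkord ?sumEFin// => k nk _; rewrite an.
by move=> k _; rewrite lee_fin.
Qed.

Section Glue.
Context {R : realType} (t : R) (t0 : 0 < t).
Local Notation mu := (@lebesgue_Rplus R).

Lemma cmeasurable_glue (F : nat -> R -> R[i]) :
  (forall k, cmeasurable (F k : measurableTypeR R -> _)) ->
  cmeasurable (glue t F : measurableTypeR R -> _).
Proof.
move=> mF; split.
  have := @measurable_glue R t t0 (fun k x => complex.Re (F k x)) (fun k => (mF k).1).
  by apply: eq_measurable_fun => x _; rewrite /glue; case: ifP.
have := @measurable_glue R t t0 (fun k x => complex.Im (F k x)) (fun k => (mF k).2).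
by apply: eq_measurable_fun => x _; rewrite /glue; case: ifP.
Qed.

Lemma sqint_fibres (f : R -> R[i]) : cmeasurable (f : measurableTypeR R -> _) ->
  (sqint mu f = \int[mu]_(x in `[0%R, t[)
     \sum_(0 <= k <oo) (sqmod (f (x + k%:R * t)))%:E)%E.
Proof.
move=> mf; rewrite /sqint (ge0_integral_fibres t0)//.
  by apply/measurable_EFinP/measurable_sqmod.
by move=> x; rewrite lee_fin sqmod_ge0.
Qed.

Lemma sqint_glue (F : nat -> R -> R[i]) :
  (forall k, cmeasurable (F k : measurableTypeR R -> _)) ->
  (sqint mu (glue t F) = \int[mu]_(x in `[0%R, t[)
     \sum_(0 <= k <oo) (sqmod (F k x))%:E)%E.
Proof.
move=> mF; rewrite sqint_fibres; last exact: cmeasurable_glue.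
apply: eq_integral => x; rewrite inE => xt.
by apply: eq_eseriesr => k _; rewrite glueE.
Qed.

Lemma measurable_fibre_sum (F : nat -> R -> R[i]) (D : set (measurableTypeR R)) :
  (forall k, cmeasurable (F k : measurableTypeR R -> _)) ->
  measurable_fun D (fun x => \sum_(0 <= k <oo) (sqmod (F k x))%:E)%E.
Proof.
move=> mF; apply: measurable_funTS; apply: ge0_emeasurable_sum.
  by move=> k x _ _; rewrite lee_fin sqmod_ge0.
by move=> k _; apply/measurable_EFinP/measurable_sqmod.
Qed.

(** The squared norm is the integral over [[0, t[] of the fibre sums, hence at most [D t]. *)
Lemma L2_glue (F : nat -> R -> R[i]) (D : R) :
  (forall k, cmeasurable (F k : measurableTypeR R -> _)) ->
  (forall x, `[0, t[%classic x -> (\sum_(0 <= k <oo) (sqmod (F k x))%:E <= D%:E)%E) ->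
  glue t F \in L2pred mu.
Proof.
move=> mF FD; apply/L2predP; split; first exact: cmeasurable_glue.
have mI : measurable (`[0, t[%classic : set (measurableTypeR R)) by exact: measurable_itv.
have D0 : 0 <= D.
  rewrite -lee_fin (le_trans _ (FD 0 _))//; last by rewrite /= in_itv /= lexx.
  by apply: nneseries_ge0 => k _ _; rewrite lee_fin sqmod_ge0.
rewrite sqint_glue//.
apply: (@le_lt_trans _ _ (\int[mu]_(x in `[0%R, t[) (cst D%:E) x)%E); last first.
  rewrite integral_cst// -{1}[t]add0r lebesgue_Rplus_itv//; last exact: ltW.
  by rewrite -EFinM ltry.
apply: ge0_le_integral => //.
- by move=> x _; apply: nneseries_ge0 => k _ _; rewrite lee_fin sqmod_ge0.
- exact: measurable_fibre_sum.
Qed.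

End Glue.

Section TestFunctions.
Context {R : realType} (t : R) (t0 : 0 < t) (psi : R -> R).
Local Notation mu := (@lebesgue_Rplus R).
Hypothesis adm : admissible t psi.
Variables (w : R[i]) (K : R).
Hypothesis K0 : 0 <= K.
Hypothesis HK : forall G : L2 mu, sqnorm G <= K * sqnorm (w *: G - bshift t psi G).

Let psi0 x : 0 < psi x. Proof. by case: adm. Qed.
Let psiV_ge0 x : 0 <= (psi x)^-1. Proof. by rewrite invr_ge0 ltW. Qed.
Let cpsi : continuous psi. Proof. by case: adm. Qed.

Let cpsiV (c : R) : continuous (fun x => (psi (x + c))^-1).
Proof.
move=> x; apply: (@continuous_comp _ _ _ (fun z => z + c) (fun x => (psi x)^-1)).
  by apply: cvgD; [exact: cvg_id|exact: cvg_cst].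
exact: (continuous_psiV adm).
Qed.

(** The squared l2 norm, along the fibre of [x], of the test function below when [x] is in [J]. *)
Let Sn (n : nat) (x : R) := \sum_(j < n.+1) sqmod w ^+ j / psi (x + j%:R * t).

Let cSn n : continuous (Sn n).
Proof.
move=> x; apply: cvg_big => [|j _]; first exact: add_continuous.
by apply: cvgM; [exact: cvg_cst|exact: cpsiV].
Qed.

Let Sn0 n x : 0 <= Sn n x.
Proof. by apply: sumr_ge0 => j _; rewrite mulr_ge0// exprn_ge0// sqmod_ge0. Qed.

(** Along a fibre, [w^j / sqrt psi] is a formal eigenvector of the backward shift for [w]. It is cut
    after level [n], and [J] selects the fibres. *)
Let test (J : set R) (n : nat) (j : nat) (x : R) : R[i] :=
  if (j <= n)%N then w ^+ j * (\1_J x / sqrtr (psi (x + j%:R * t)))%:C else 0.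

Let mtest (J : set (measurableTypeR R)) n j : measurable J ->
  cmeasurable (test J n j : measurableTypeR R -> _).
Proof.
move=> mJ; rewrite /test; case: (j <= n)%N; last exact: cmeasurable_cst.
apply: cmeasurableM; first exact: cmeasurable_cst.
apply: cmeasurable_real; apply: measurable_funM; first exact: measurable_indic.
have := measurableT_comp (continuous_measurable_fun (@sqrt_continuous R))
   (continuous_measurable_fun (@cpsiV (j%:R * t))).
by apply: eq_measurable_fun => x _ /=; rewrite sqrtrV ?ltW.
Qed.

Let sqmod_test (J : set R) n j x : sqmod (test J n j x) =
  if (j <= n)%N then \1_J x * (sqmod w ^+ j / psi (x + j%:R * t)) else 0.
Proof.
rewrite /test; case: ifP => _; last exact: sqmod0.
rewrite sqmodM sqmodX sqmod_real expr_div_n sqr_sqrtr ?(ltW (psi0 _))//.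
by rewrite indicE; case: (x \in J); rewrite ?expr1n ?expr0n ?mul1r// !mul0r mulr0.
Qed.

Let sum_test (J : set R) n x :
  (\sum_(0 <= k <oo) (sqmod (test J n k x))%:E)%E = (\1_J x * Sn n x)%:E.
Proof.
rewrite (@nneseries_finite _ _ n.+1).
- rewrite /Sn mulr_sumr; congr EFin; apply: eq_bigr => j _.
  by rewrite sqmod_test -ltnS ltn_ord.
- by move=> k; exact: sqmod_ge0.
- by move=> k nk; rewrite sqmod_test leqNgt nk.
Qed.

Let sqint_test (J : set (measurableTypeR R)) n : measurable J -> J `<=` `[0, t[%classic ->
  (sqint mu (glue t (test J n)) = \int[mu]_(x in J) (Sn n x)%:E)%E.
Proof.
move=> mJ Jt; rewrite sqint_glue//; last by move=> k; exact: mtest.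
rewrite -[in RHS](setIidr Jt) integral_mkcondr; apply: eq_integral => x _.
rewrite sum_test patchE indicE.
by case: (x \in J); rewrite ?mul1r ?mul0r.
Qed.

Let Sn_bound n : exists D, forall x, `[0, t[%classic x -> Sn n x <= D.
Proof.
have [c _ Hc] := @EVT_max R (Sn n) 0 t (ltW t0) (continuous_subspaceT (@cSn n)).
exists (Sn n c) => x /=; rewrite in_itv /= => /andP[x0 xt]; apply: Hc.
by rewrite in_itv /= x0 ltW.
Qed.

Let L2_test (J : set (measurableTypeR R)) n : measurable J ->
  glue t (test J n) \in L2pred mu.
Proof.
move=> mJ; have [D HD] := Sn_bound n.
apply: (@L2_glue _ _ t0 _ D); first by move=> k; exact: mtest.
move=> x xt; rewrite sum_test lee_fin; apply: le_trans (HD x xt).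
by rewrite indicE; case: (x \in J); rewrite ?mul1r ?mul0r.
Qed.

(** The image of the test function under [w] minus the backward shift: the cut leaves an error at
    level [n] only. *)
Let tail (J : set R) (n : nat) (j : nat) (x : R) : R[i] :=
  if j == n then w ^+ n.+1 * (\1_J x / sqrtr (psi (x + n%:R * t)))%:C else 0.

Let mtail (J : set (measurableTypeR R)) n j : measurable J ->
  cmeasurable (tail J n j : measurableTypeR R -> _).
Proof.
move=> mJ; rewrite /tail; case: (j == n); last exact: cmeasurable_cst.
have := cmeasurableM (cmeasurable_cst w) (@mtest J n n mJ).
by rewrite /test leqnn; under eq_fun do rewrite mulrA -exprS.
Qed.

(** Below level [n] the two terms cancel, above it both vanish, and at level [n] the second one has
    been cut off. *)
Let tail_test J n j x : `[0, t[%classic x -> w * test J n j x -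
    (sqrtr (psi (x + j.+1%:R * t) / psi (x + j%:R * t)))%:C * test J n j.+1 x =
  tail J n j x.
Proof.
move=> xt; rewrite /test /tail; case: (ltngtP j n) => [jn|jn|->].
- have -> : \1_J x / sqrtr (psi (x + j%:R * t)) =
      sqrtr (psi (x + j.+1%:R * t) / psi (x + j%:R * t)) *
      (\1_J x / sqrtr (psi (x + j.+1%:R * t))).
    rewrite sqrtrM ?(ltW (psi0 _))// sqrtrV ?(ltW (psi0 _))//.
    by field; rewrite !gt_eqF ?sqrtr_gt0.
  by rewrite rmorphM /= exprS; ring.
- by rewrite !mulr0 subr0.
- by rewrite !mulrA -exprS mulr0 subr0.
Qed.

Let sqint_tail (J : set (measurableTypeR R)) n : measurable J -> J `<=` `[0, t[%classic ->
  (sqint mu (glue t (tail J n)) =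
   \int[mu]_(x in J) (sqmod w ^+ n.+1 / psi (x + n%:R * t))%:E)%E.
Proof.
move=> mJ Jt; rewrite sqint_glue//; last by move=> k; exact: mtail.
rewrite -[in RHS](setIidr Jt) integral_mkcondr; apply: eq_integral => x _.
rewrite (@nneseries_finite _ _ n.+1); last 2 first.
- by move=> k; exact: sqmod_ge0.
- by move=> k nk; rewrite /tail gtn_eqF// sqmod0.
rewrite big_ord_recr big1 /= ?add0r; last first.
  by move=> k _; rewrite /tail ltn_eqF// sqmod0.
rewrite patchE /tail eqxx sqmodM sqmodX sqmod_real expr_div_n sqr_sqrtr ?(ltW (psi0 _))//.
by rewrite indicE; case: (x \in J); rewrite ?expr1n ?mul1r// expr0n mul0r mulr0.
Qed.

Let L2class_test J n : measurable (J : set (measurableTypeR R)) ->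
  J `<=` `[0, t[%classic ->
  {ae mu, forall x, repr (w *: L2class mu (glue t (test J n)) -
    bshift t psi (L2class mu (glue t (test J n)))) x = glue t (tail J n) x}.
Proof.
move=> mJ Jt; set G := L2class _ _.
have e1 := L2_reprB (w *: G) (bshift t psi G).
have e2 := L2_reprZ w G; have e3 := bshift_repr t0 adm G.
have e4 := @L2class_repr _ _ _ mu _ (@L2_test J n mJ).
have e5 := ae_Rplus_addr (ltW t0) e4.
apply: filterS2 (filterI e1 e2) (filterI (filterI e3 ae_Rplus_ge0) (filterI e4 e5)).
move=> x [-> ->] [[-> /(fibre_ex t0) [k [y [yt xE]]]] [E4 E5]].
rewrite /bwd E4 E5 xE.
have <- : y + k.+1%:R * t = y + k%:R * t + t by rewrite -natr1; ring.
by rewrite !glueE// tail_test.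
Qed.

(** For [J = [y, y + e[], the hypothesis [HK] on the test function compares the integrals over [J]
    of the two sides; both being continuous, they compare at [y]. *)
Lemma bounded_below_bshift n y : 0 <= y < t ->
  \sum_(j < n.+1) sqmod w ^+ j / psi (y + j%:R * t) <=
    K * sqmod w * (sqmod w ^+ n / psi (y + n%:R * t)).
Proof.
move=> /andP[y0 yt].
have cG : continuous (fun x : R => K * sqmod w * (sqmod w ^+ n / psi (x + n%:R * t))).
  move=> x; apply: cvgM; first exact: cvg_cst.
  by apply: cvgM; [exact: cvg_cst|exact: cpsiV].
have G0 x : 0 <= K * sqmod w * (sqmod w ^+ n / psi (x + n%:R * t)).
  by rewrite mulr_ge0// mulr_ge0// ?exprn_ge0// sqmod_ge0.
(* The bound [t - y] on [e] keeps [J] inside [[0, t[], so that distinct points of [J] lie on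
   distinct fibres. *)
apply: (@continuous_le_of_integral R (Sn n) _ y (t - y) (@cSn n) cG) => //.
  by rewrite subr_gt0.
move=> e e0 et; set J := `[y, (y + e)[%classic.
have mJ : measurable (J : set (measurableTypeR R)) by exact: measurable_itv.
have Jt : J `<=` `[0, t[%classic.
  move=> x; rewrite /J /= !in_itv /= => /andP[yx xe]; rewrite (le_trans y0 yx) /=.
  by rewrite (lt_trans xe)// -ltrBrDl.
have := HK (L2class mu (glue t (test J n))).
rewrite -lee_fin EFinM !sqnormE -(sqint_test n mJ Jt).
set G := L2class _ _ => HG.
have -> : sqint mu (glue t (test J n)) = sqint mu (repr G).
  apply: sqint_ae; first by apply: cmeasurable_glue => // k; exact: mtest.
    exact: cmeasurable_repr.
  by apply: filterS (@L2class_repr _ _ _ mu _ (@L2_test J n mJ)) => x ->.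
apply: (le_trans HG).
have -> : sqint mu (repr (w *: G - bshift t psi G)) = sqint mu (glue t (tail J n)).
  apply: sqint_ae; first exact: cmeasurable_repr.
    by apply: cmeasurable_glue => // k; exact: mtail.
  exact: L2class_test.
rewrite sqint_tail// -ge0_integralZl//; last 2 first.
- apply/measurable_EFinP; apply: measurable_funTS; apply: measurable_funM => //.
  exact: continuous_measurable_fun (@cpsiV (n%:R * t)).
- by move=> x _; rewrite lee_fin mulr_ge0// exprn_ge0// sqmod_ge0.
rewrite le_eqVlt; apply/orP; left; apply/eqP; apply: eq_integral => x _.
by rewrite -EFinM exprS !mulrA.
Qed.

End TestFunctions.

(** * Sequences whose terms dominate their partial sums *)

Section GrowingSequences.
Context {R : realType} (p : nat -> R) (C : R).
Hypothesis p0 : forall k, 0 < p k.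
Hypothesis pC : forall n, \sum_(j < n.+1) p j <= C * p n.

Local Notation P n := (\sum_(j < n.+1) p j).

Lemma growth_ge1 : 1 <= C.
Proof. by have := pC 0; rewrite big_ord1 -{1}[p 0%N]mul1r ler_pM2r. Qed.

Let C0 : 0 < C. Proof. exact: lt_le_trans growth_ge1. Qed.

Let q_ge0 : 0 <= 1 - C^-1.
Proof. by rewrite subr_ge0 invf_le1// growth_ge1. Qed.

Lemma partial_sum_gt0 n : 0 < P n.
Proof.
rewrite big_ord_recr /= ltr_wpDl//.
by apply: sumr_ge0 => j _; exact: ltW.
Qed.

(** The last term of [P n.+1] is at least the fraction [1 / C] of the whole; removing it leaves at
    most [1 - 1 / C]. *)
Lemma partial_sum_contract n : P n <= (1 - C^-1) * P n.+1.
Proof.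
have -> : P n = P n.+1 - p n.+1 by rewrite [P n.+1]big_ord_recr /= addrK.
by rewrite mulrBl mul1r lerD2l lerN2 ler_pdivrMl// pC.
Qed.

Lemma partial_sum_geometric n : p 0 <= (1 - C^-1) ^+ n * P n.
Proof.
elim: n => [|n IH]; first by rewrite big_ord1 expr0 mul1r.
apply: (le_trans IH); rewrite exprSr -mulrA.
by rewrite ler_wpM2l ?exprn_ge0// partial_sum_contract.
Qed.

(** Since [p 0 <= (1 - 1/C)^k P k <= (1 - 1/C)^k C p k], the inverses are dominated by [C / p 0]
    times a geometric sequence whose partial sums are at most [C]. *)
Lemma sum_inv_growth n : \sum_(k < n) (p k)^-1 <= C ^+ 2 / p 0.
Proof.
have pk k : (p k)^-1 <= C / p 0 * (1 - C^-1) ^+ k.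
  rewrite mulrAC ler_pdivlMr// mulrC ler_pdivrMr//.
  apply: (le_trans (partial_sum_geometric k)).
  by rewrite -mulrA mulrCA ler_wpM2l ?exprn_ge0.
apply: (le_trans (ler_sum _ (fun (k : 'I_n) _ => pk k))).
have -> : C ^+ 2 / p 0%N = C / p 0%N * C by rewrite expr2 mulrAC.
rewrite -mulr_sumr ler_wpM2l ?divr_ge0 ?(ltW C0) ?(ltW (p0 0))//.
have := subrX1 (1 - C^-1) n; rewrite addrAC subrr add0r => h.
have h' : C^-1 * \sum_(i < n) (1 - C^-1) ^+ i = 1 - (1 - C^-1) ^+ n.
  by rewrite -[LHS]opprK -mulNr -h opprB.
by rewrite -[leRHS]mulr1 -ler_pdivrMl// h' gerBl exprn_ge0.
Qed.

(* The ratios [p k / P k], which lie in [[1/C, 1]], are the weights making the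
   recursion a strict contraction. *)
Lemma recursion_bound (F U : nat -> R) (r m e : R) :
  0 <= r -> 0 < e -> (forall k, 0 <= F k) -> (forall k, 0 <= U k) ->
  m * F 0%N <= (1 + e^-1) * U 0%N ->
  (forall k, m * F k.+1 <= (1 + e^-1) * U k.+1 + (1 + e) * (r * (p k / p k.+1) * F k)) ->
  (1 + e) * (r * (1 - C^-1)) < m ->
  forall n, \sum_(k < n) F k <=
    C * ((1 + e^-1) / (m - (1 + e) * (r * (1 - C^-1)))) * \sum_(k < n) U k.
Proof.
move=> r0 e0 F0 U0 H0 HS hm n.
set s := (1 + e) * (r * (1 - C^-1)) in hm *.
have ms0 : 0 < m - s by rewrite subr_gt0.
have e1 : 0 <= 1 + e by rewrite addr_ge0// ltW.
have e2 : 0 <= 1 + e^-1 by rewrite addr_ge0// invr_ge0 ltW.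
pose W k := p k / P k.
have W0 k : 0 <= W k by rewrite divr_ge0// ltW// partial_sum_gt0.
have W1 k : W k <= 1.
  rewrite ler_pdivrMr ?partial_sum_gt0// mul1r big_ord_recr /= lerDr.
  by apply: sumr_ge0 => j _; exact: ltW.
have WC k : 1 <= C * W k.
  by rewrite mulrA ler_pdivlMr ?partial_sum_gt0// mul1r.
pose A n := \sum_(k < n) W k * F k.
have A0 j : 0 <= A j by apply: sumr_ge0 => k _; rewrite mulr_ge0.
(* Multiplying [HS j] by [W j.+1] turns the coupling term into [r p_j F_j / P_(j+1)], which
   [partial_sum_contract] bounds by [r (1 - 1/C) W_j F_j]. Summing gives a recursion for the
   weighted sums [A]. *)
have step j : m * A j.+1 <= (1 + e^-1) * (\sum_(k < j.+1) U k) + s * A j.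
  elim: j => [|j IH].
    have W00 : W 0%N = 1 by rewrite /W big_ord1 mulfV// gt_eqF.
    by rewrite /A !big_ord1 big_ord0 W00 mul1r mulr0 addr0.
  rewrite [A j.+2]big_ord_recr /= -/(A j.+1) mulrDr.
  rewrite [X in (1 + e^-1) * X]big_ord_recr /= mulrDr.
  rewrite [A j.+1 in leRHS]big_ord_recr /= -/(A j) mulrDr.
  rewrite addrACA; apply: lerD => //.
  rewrite mulrCA; apply: (le_trans (ler_wpM2l (W0 _) (HS j))).
  rewrite mulrDr; apply: lerD.
    by rewrite mulrCA ler_wpM2l// ler_piMl.
  rewrite mulrCA /s -[leRHS]mulrA ler_wpM2l//.
  have -> : W j.+1 * (r * (p j / p j.+1) * F j) = r * (p j * F j) / P j.+1.
    by rewrite /W; field; rewrite !gt_eqF// partial_sum_gt0.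
  have -> : r * (1 - C^-1) * (W j * F j) = r * (p j * F j) * ((1 - C^-1) / P j).
    by rewrite /W; ring.
  rewrite ler_wpM2l//; first by rewrite mulr_ge0// mulr_ge0// ltW.
  rewrite ler_pdivlMr ?partial_sum_gt0// mulrC ler_pdivrMr ?partial_sum_gt0//.
  exact: partial_sum_contract.
(* As [A] is nondecreasing, the term [s * A n] is absorbed into the left-hand side. *)
have AU : (m - s) * A n <= (1 + e^-1) * \sum_(k < n) U k.
  case: n => [|n]; first by rewrite /A !big_ord0 !mulr0.
  rewrite mulrBl lerBlDr; apply: (le_trans (step n)); rewrite lerD2l.
  rewrite ler_wpM2l//; last by rewrite /A [leRHS]big_ord_recr /= lerDl mulr_ge0.
  by rewrite /s mulr_ge0// mulr_ge0.
(* The weights are at least [1 / C], so dropping them costs a factor [C]. *)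
apply: (@le_trans _ _ (C * A n)).
  rewrite /A mulr_sumr; apply: ler_sum => k _.
  by rewrite mulrA ler_peMl.
rewrite -mulrA ler_wpM2l ?(ltW C0)// mulrAC ler_pdivlMr//.
by rewrite mulrC.
Qed.

End GrowingSequences.

(** * Symbols *)

Section Symbols.
Context {R : realType} (t : R) (t0 : 0 < t).
Local Notation mu := (@lebesgue_Rplus R).

(* The symbol is only controlled on [0, +oo[; freezing it on the other half-line
   makes it continuous and positive on R without changing the operators. *)
Definition extend (phi : R -> R) (x : R) : R := phi (Num.max x 0).

Lemma extendE phi x : 0 <= x -> extend phi x = phi x.
Proof. by move=> x0; rewrite /extend max_l. Qed.

(** [Num.max y 0] never leaves the half-line, so continuity of [phi] within it suffices for the
    composition. *)
Lemma extend_continuous (phi : R -> R) : {within `[0, +oo[, continuous phi} ->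
  continuous (extend phi).
Proof.
move=> /subspace_continuousP cphi x.
have m0 (y : R) : `[0, +oo[%classic (Num.max y 0) by rewrite /= in_itv /= andbT le_max lexx orbT.
have cmax : Num.max y 0 @[y --> x] --> Num.max x 0.
  by apply: (@continuous_max _ _ id (cst 0)); [exact: cvg_id|exact: cvg_cst].
apply: (@cvg_comp _ _ _ (fun y => Num.max y 0) phi); last exact: (cphi _ (m0 x)).
move=> A /cmax hA.
have {}hA : nbhs x (fun y => `[0, +oo[%classic (Num.max y 0) -> A (Num.max y 0)) := hA.
rewrite /nbhs /=; apply: (@filterS _ (nbhs x)) hA => y; apply; exact: m0.
Qed.

Lemma wtranslation_extend phi :
  wtranslation (extend phi) t = wtranslation phi t :> (L2 mu -> L2 mu).
Proof.
apply/funext => F; congr L2class; apply/funext => x; case: ifP => // tx.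
by rewrite !extendE ?subr_ge0// (le_trans (ltW t0)).
Qed.

(** The essential bound on the weight gives an almost everywhere bound on [psi (x + t) / psi x];
    continuity of the ratio makes it hold at every point of the half-line. *)
Lemma is_symbol_admissible phi : is_symbol phi -> admissible t (extend phi).
Proof.
move=> [cphi phi0 ess]; set psi := extend phi.
have cpsi : continuous psi by exact: extend_continuous.
have psi0 x : 0 < psi x by apply: phi0; rewrite le_max lexx orbT.
split => //.
have [c c0 Hc] : exists2 c : R, 0 <= c & {ae mu, forall x, weight phi t x <= c}.
  have := ess t (ltW t0); have := ess_sup_ge mu (fun x => `|weight phi t x|%:E).
  (* The value [-oo] would make the almost everywhere bound absurd, so 0 serves there. *)
  case: (ess_sup _ _) => [c|//|] h _; last first.
    exists 0 => //; apply: filterS h => x; rewrite leNgt.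
    by rewrite ltNye_eq.
  exists `|c| => //; apply: filterS h => x; rewrite lee_fin => h.
  by rewrite (le_trans (ler_norm _))// (le_trans h)// ler_norm.
exists (c ^+ 2 + 1); first by rewrite ltr_wpDl ?sqr_ge0.
have aeF : {ae mu, forall x, psi (x + t) / psi x <= c ^+ 2}.
  apply: filterS2 ae_Rplus_ge0 (ae_Rplus_addr (ltW t0) Hc) => x x0.
  rewrite /weight lerDr x0 addrK -!(@extendE phi) ?addr_ge0 ?(ltW t0)// -/psi => h.
  rewrite -[leLHS]sqr_sqrtr ?divr_ge0 ?(ltW (psi0 _))//.
  by rewrite ler_pXn2r// nnegrE sqrtr_ge0.
have cV : continuous (fun x => (psi x)^-1).
  by move=> x; apply: cvgV; [rewrite gt_eqF|exact: cpsi].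
have cF : continuous (fun x => psi (x + t) / psi x).
  move=> x; apply: cvgM.
    apply: (@continuous_comp _ _ _ (fun z => z + t) psi); last exact: cpsi.
    by apply: cvgD; [exact: cvg_id|exact: cvg_cst].
  exact: cV.
move=> y y0; rewrite -ler_pdivrMr//.
apply: (@le_trans _ _ (c ^+ 2)); last by rewrite lerDl.
apply: (@continuous_le_of_integral R _ (cst (c ^+ 2)) y 1 cF) => //.
- by move=> x; exact: cvg_cst.
- by move=> x _; rewrite divr_ge0// ltW.
- by move=> x _; exact: sqr_ge0.
move=> e e0 _.
have mI : measurable (`[y, (y + e)[%classic : set (measurableTypeR R)) by exact: measurable_itv.
apply: ae_ge0_le_integral => //.
- by move=> x _; rewrite lee_fin divr_ge0// ltW.
- by apply/measurable_EFinP/measurable_funTS; exact: continuous_measurable_fun.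
- by move=> x _; rewrite lee_fin sqr_ge0.
- by apply/measurable_EFinP; exact: measurable_cst.
- by apply: filterS aeF => x h _; rewrite lee_fin.
Qed.

End Symbols.

Section Indicators.
Context {R : realType}.
Local Notation mu := (@lebesgue_Rplus R).

Lemma cmeasurable_indic (J : set (measurableTypeR R)) : measurable J ->
  cmeasurable ((fun x => (\1_J x)%:C) : measurableTypeR R -> R[i]).
Proof. by move=> mJ; apply: cmeasurable_real; exact: measurable_indic. Qed.

Lemma sqint_indicM (J : set (measurableTypeR R)) (h : R -> R) :
  sqint mu (fun x => (h x * \1_J x)%:C) = (\int[mu]_(x in J) (h x ^+ 2)%:E)%E.
Proof.
rewrite [RHS]integral_mkcond; apply: eq_integral => x _.
rewrite patchE sqmod_real indicE; case: (x \in J); first by rewrite mulr1.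
by rewrite mulr0 expr0n.
Qed.

Lemma indic_L2 (y e : R) : 0 <= y -> 0 <= e ->
  (fun x => (\1_(`[y, (y + e)[%classic : set R) x)%:C) \in L2pred mu.
Proof.
move=> y0 e0; have mJ : measurable (`[y, (y + e)[%classic : set (measurableTypeR R)).
  exact: measurable_itv.
apply/L2predP; split; first exact: cmeasurable_indic.
have := sqint_indicM `[y, (y + e)[%classic (cst 1).
under eq_fun do rewrite mul1r; move=> ->.
under eq_integral do rewrite expr1n.
by rewrite integral_cst// mul1e lebesgue_Rplus_itv// ltry.
Qed.

(** A null class would vanish off a null set, which cannot contain [[0, e[]. *)
Lemma L2_neq0 (F : L2 mu) (f : R -> R[i]) (e : R) : 0 < e ->
  {ae mu, forall x, repr F x = f x} -> (forall x, 0 <= x < e -> f x != 0) -> F != 0.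
Proof.
move=> e0 Ff f0; apply/negP => /eqP F0.
have [N [mN N0 HN]] : {ae mu, forall x, f x = 0}.
  by apply: filterS2 Ff (L2_repr0 mu) => x <-; rewrite F0.
have mI : measurable (`[0, (0 + e)[%classic : set (measurableTypeR R)) by exact: measurable_itv.
have : (mu `[0%R, (0 + e)%R[%classic <= mu N)%E.
  apply: le_measure; rewrite ?inE// => x; rewrite /= in_itv /= add0r => /f0 fx.
  by apply: HN => /= fx0; rewrite fx0 eqxx in fx.
by rewrite N0 lebesgue_Rplus_itv ?(ltW e0)// lee_fin leNgt e0.
Qed.

End Indicators.

Section LeftInvertible.
Context {R : realType} (t : R) (t0 : 0 < t) (psi : R -> R).
Local Notation mu := (@lebesgue_Rplus R).
Hypothesis adm : admissible t psi.

(** A bounded left inverse gives [|F|^2 <= K |S F|^2]. On the indicator of a short interval at [y]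
    this compares the integrals of 1 and of [K psi (x + t) / psi x], hence their values at [y]. *)
Lemma left_invertible_admissibleV :
  left_invertible (@L2dot _ _ R mu) (wtranslation psi t) ->
  admissible t (fun x => (psi x)^-1).
Proof.
move=> [B /bounded_operatorP[_ [K K0 HK]] BS].
have [cpsi psi0 _] := adm.
split; [exact: (continuous_psiV adm)|by move=> x; rewrite invr_gt0|].
exists K => // y y0.
have cF : continuous (fun x => K * (psi (x + t) / psi x)).
  move=> x; apply: cvgM; first exact: cvg_cst.
  apply: cvgM; last exact: (continuous_psiV adm).
  apply: (@continuous_comp _ _ _ (fun z => z + t) psi); last exact: cpsi.
  by apply: cvgD; [exact: cvg_id|exact: cvg_cst].
suff : 1 <= K * (psi (y + t) / psi y).
  by rewrite mulrA mulrAC -ler_pdivrMr// div1r.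
apply: (@continuous_le_of_integral R (cst 1) _ y 1 _ cF) => //.
- by move=> x; exact: cvg_cst.
- by move=> x _; rewrite mulr_ge0 ?(ltW K0)// divr_ge0// ltW.
move=> e e0 _; set J := `[y, (y + e)[%classic.
have mJ : measurable (J : set (measurableTypeR R)) by exact: measurable_itv.
pose f (x : R) : R[i] := (\1_J x)%:C.
have fL : f \in L2pred mu by apply: indic_L2 => //; exact: ltW.
have mf : cmeasurable (f : measurableTypeR R -> _) by exact: cmeasurable_indic.
have fE := @L2class_repr _ _ _ mu _ fL.
have := HK (wtranslation psi t (L2class mu f)).
rewrite BS -lee_fin EFinM !sqnormE.
have -> : sqint mu (repr (L2class mu f)) = (\int[mu]_(x in J) (cst 1 x)%:E)%E.
  rewrite (sqint_ae _ mf fE); last exact: cmeasurable_repr.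
  have := sqint_indicM J (cst 1); under eq_fun do rewrite mul1r.
  by move=> ->; under eq_integral do rewrite expr1n.
move=> /le_trans; apply.
have -> : sqint mu (repr (wtranslation psi t (L2class mu f))) = sqint mu (fwd t psi f).
  apply: sqint_ae; [exact: cmeasurable_repr|exact: cmeasurable_fwd|].
  apply: filterS2 (wtranslation_repr t0 adm (L2class mu f)) (ae_Rplus_subr (ltW t0) fE).
  by move=> x ->; rewrite /fwd; case: ifP => // _ ->.
rewrite /fwd sqint_shift//; last exact: cmeasurable_weight_subr.
have := sqint_indicM J (fun x => sqrtr (psi (x + t) / psi x)) => E.
under eq_fun do rewrite addrK -rmorphM /=.
rewrite E -ge0_integralZl//; last 2 first.
- apply/measurable_EFinP; apply: measurable_funX; apply: measurable_funTS.
  by have := measurable_sqrt_ratio adm t 0; under eq_fun do rewrite addr0.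
- by rewrite lee_fin ltW.
rewrite le_eqVlt; apply/orP; left; apply/eqP; apply: eq_integral => x _.
by rewrite -EFinM sqr_sqrtr// divr_ge0// ltW.
Qed.

End LeftInvertible.

(** * Spectral properties *)

Section SpectralProperties.
Context {R : realType} (t : R) (t0 : 0 < t) (psi : R -> R).
Local Notation mu := (@lebesgue_Rplus R).
Local Notation dot := (@L2dot _ _ R mu).
Local Notation S := (wtranslation psi t : L2 mu -> L2 mu).
Hypothesis adm : admissible t psi.

Let psi0 x : 0 < psi x. Proof. by case: adm. Qed.
Let cpsi : continuous psi. Proof. by case: adm. Qed.

Lemma wtranslation_no_eigenvector (z : R[i]) (F : L2 mu) : S F = z *: F -> F = 0.
Proof.
move=> SF.
have e1 : {ae mu, forall x, z * repr F x = fwd t psi (repr F) x}.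
  apply: filterS2 (wtranslation_repr t0 adm F) (L2_reprZ z F) => x <- <-.
  by rewrite SF.
apply: L2_ext.
have [z0|z0] := eqVneq z 0.
  (* For [z = 0], the equation read at [x + t] is a positive weight times the value of [F] at [x],
     equal to 0. *)
  apply: filterS2 (filterI ae_Rplus_ge0 (L2_repr0 mu)) (ae_Rplus_addr (ltW t0) e1).
  move=> x [x0 ->]; rewrite z0 mul0r /fwd lerDr x0 addrK => /esym/eqP.
  rewrite mulf_eq0 => /orP[|/eqP//]; rewrite eq_complex /= eqxx andbT.
  by rewrite gt_eqF// sqrtr_gt0 divr_gt0.
have vanish n : {ae mu, forall x, x < n%:R * t -> repr F x = 0}.
  elim: n => [|n IH].
    by apply: filterS ae_Rplus_ge0 => x x0; rewrite mul0r ltNge x0.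
  apply: filterS2 e1 (ae_Rplus_subr (ltW t0) IH) => x + {}IH xn.
  rewrite /fwd; case: ifP => [tx|_].
    rewrite IH// ?mulr0; last first.
      by rewrite ltrBlDr; move: xn; rewrite -natr1 mulrDl mul1r.
    by move=> /eqP; rewrite mulf_eq0 (negbTE z0) => /eqP.
  by move=> /eqP; rewrite mulf_eq0 (negbTE z0) => /eqP.
have all_n : {ae mu, forall x, forall n : nat, x < n%:R * t -> repr F x = 0}.
  exact/ae_foralln.
apply: filterS2 all_n (L2_repr0 mu) => x Fx ->.
apply: (Fx (Num.bound `|x / t|)); rewrite -ltr_pdivrMr//.
by apply: (le_lt_trans (ler_norm _)); exact: archi_boundP.
Qed.

Lemma invertible_bounded_below (A : L2 mu -> L2 mu) :
  invertible_operator dot A ->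
  exists2 K : R, 0 < K & forall F, sqnorm F <= K * sqnorm (A F).
Proof.
move=> [B [/bounded_operatorP[_ [K K0 HK]] AB _]].
by exists K => // F; rewrite -{1}(AB F).
Qed.

(* With [H] the image of [G] under the adjoint of [z - S] and [B] the inverse of
   [z - S], one has [<G, G> = <(z - S) B G, G> = <B G, H>]; the estimate is then
   read off [0 <= |B G - K H|^2]. *)
Lemma resolvent_bounded_below (z : R[i]) :
  ~ spectrum dot S z ->
  exists2 K : R, 0 < K & forall G, sqnorm G <= K * sqnorm (z^* *: G - bshift t psi G).
Proof.
move=> /contrapT [B [/bounded_operatorP[_ [K K0 HK]] _ SB]].
pose d : {dot L2 mu for conjC} := dot.
have dE G : d G G = (sqnorm G)%:C := L2dotxx G.
exists K => // G; set H := _ - _.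
have GE : d G G = d (B G) H.
  rewrite -{1}(SB G) /H linearBl linearZl_LR linearBr linearZr_LR /= conjCK.
  by congr (_ - _); exact: wtranslation_adj.
have : d (B G - K%:C *: H) (B G - K%:C *: H) =
    (sqnorm (B G) - (K * sqnorm G + K * sqnorm G) + K ^+ 2 * sqnorm H)%:C.
  have HB : d H (B G) = (sqnorm G)%:C.
    have -> : d H (B G) = (d (B G) H)^* by rewrite [LHS](hermC d) expr0 mul1r.
    by rewrite -GE dE conj_realC.
  rewrite !linearBl !linearBr /= !linearZl_LR !linearZr_LR /= -!/d conj_realC.
  rewrite -GE HB !dE !(rmorphD, rmorphB, rmorphM, rmorphXn) /=.
  by ring.
rewrite dE => -[E]; have := sqnorm_ge0 (B G - K%:C *: H); rewrite E.
have := HK G => h1 h2.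
(* From [0 <= |B G|^2 - 2 K |G|^2 + K^2 |H|^2] and [|B G|^2 <= K |G|^2]. *)
have : K * sqnorm G <= K * (K * sqnorm H) by nra.
by rewrite ler_pM2l.
Qed.

End SpectralProperties.

(** * Resolvent set of the weighted translation *)

Section SpectrumDisc.
Context {R : realType} (t : R) (t0 : 0 < t) (psi : R -> R).
Local Notation mu := (@lebesgue_Rplus R).
Local Notation dot := (@L2dot _ _ R mu).
Local Notation S := (wtranslation psi t : L2 mu -> L2 mu).
Hypothesis adm : admissible t psi.

Let psi0 x : 0 < psi x. Proof. by case: adm. Qed.

(** The indicator of [[0, t[] is a nonzero element killed by the backward shift, which therefore is
    not bounded below. *)
Lemma spectrum_wtranslation0 : spectrum dot S 0.
Proof.
apply: contrapT => /(resolvent_bounded_below t0 adm) [K K0 HK].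
pose f (x : R) : R[i] := (\1_(`[0, (0 + t)[%classic : set R) x)%:C.
have fL : f \in L2pred mu by apply: indic_L2 => //; exact: ltW.
have fE := @L2class_repr _ _ _ mu _ fL; set G := L2class _ _ in fE.
have f0 x : 0 <= x < t -> f x != 0.
  by move=> xt; rewrite /f indicE mem_set ?oner_eq0//= in_itv /= add0r.
have : G != 0 by exact: (L2_neq0 t0 fE f0).
have -> : G = 0; last by rewrite eqxx.
have bG : bshift t psi G = 0.
  apply: L2_ext.
  apply: filterS2 (filterI ae_Rplus_ge0 (L2_repr0 mu))
    (filterI (bshift_repr t0 adm G) (ae_Rplus_addr (ltW t0) fE)).
  move=> x [x0 ->] [-> E]; rewrite /bwd E /f indicE memNset ?mulr0//=.
  by rewrite in_itv /= add0r => /andP[_]; rewrite ltNge lerDr x0.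
apply: sqnorm_eq0; apply/eqP; rewrite eq_le sqnorm_ge0 andbT.
apply: (le_trans (HK G)).
have -> : (0^* : R[i]) = 0 by rewrite rmorph0.
rewrite scale0r bG subr0; have -> : sqnorm (0 : L2 mu) = 0; last by rewrite mulr0.
by have := L2dotxx (0 : L2 mu); rewrite -[X in X = _]/(dot 0 0) linear0l => -[<-].
Qed.

(** * Inverting [w - S] under the growth bound, to be used with [r = |z|^2] for [z] in the resolvent
    set *)

Section Resolvent.
Variables (C r : R) (w : R[i]).
Hypothesis r0 : 0 < r.
Hypothesis growth : forall n y, `[0, t[%classic y ->
  \sum_(j < n.+1) r ^+ j / psi (y + j%:R * t) <= C * (r ^+ n / psi (y + n%:R * t)).
Hypothesis rw : r * (1 - C^-1) < sqmod w.

Let pos y k : 0 < r ^+ k / psi (y + k%:R * t).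
Proof. by rewrite divr_gt0// exprn_gt0. Qed.

Let C1 : 1 <= C.
Proof.
apply: (growth_ge1 (pos 0) (fun n => growth n _)).
by rewrite /= in_itv /= lexx.
Qed.

Let a_ge0 : 0 <= r * (1 - C^-1).
Proof. by rewrite mulr_ge0 ?(ltW r0)// subr_ge0 invf_le1// (lt_le_trans ltr01). Qed.

Let w0 : w != 0.
Proof. by rewrite -sqmod_gt0 (le_lt_trans a_ge0). Qed.

(** The equation [(w - S) f = u] solved level by level: at level 0 it reads [w f = u], and each
    further level involves only the preceding one. *)
Fixpoint resolvent_fibre (u : R -> R[i]) (k : nat) (y : R) : R[i] :=
  if k is j.+1 then
    w^-1 * (u (y + j.+1%:R * t) + (sqrtr (psi (y + j.+1%:R * t) / psi (y + j%:R * t)))%:C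
       * resolvent_fibre u j y)
  else w^-1 * u y.

Let cmeasurable_resolvent u k : cmeasurable (u : measurableTypeR R -> _) ->
  cmeasurable (resolvent_fibre u k : measurableTypeR R -> _).
Proof.
move=> mu_; elim: k => [|k IH] /=.
  by apply: cmeasurableM => //; exact: cmeasurable_cst.
apply: cmeasurableM; first exact: cmeasurable_cst.
apply: cmeasurableD; first exact: cmeasurable_addr.
apply: cmeasurableM => //; apply: cmeasurable_real.
exact: (measurable_sqrt_ratio adm).
Qed.

(** An instance of [recursion_bound] with [p k = r^k / psi (y + k t)], for which the squared weight
    between consecutive levels is [r p_k / p_(k+1)]. The constant does not depend on the fibre, so
    the bound can be integrated. *)
Let resolvent_bound : exists2 D : R, 0 < D & forall u y n, `[0, t[%classic y ->
  \sum_(k < n) sqmod (resolvent_fibre u k y) <=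
    D * \sum_(k < n) sqmod (u (y + k%:R * t)).
Proof.
pose a := r * (1 - C^-1); pose b := sqmod w.
have ab : a < b := rw; have a0 : 0 <= a := a_ge0.
have [e e0 eb] : exists2 e : R, 0 < e & (1 + e) * a < b.
  (* With this [e], the excess [e a] is less than half of [b - a]; the [+ 1] covers [a = 0]. *)
  exists ((b - a) / (2 * (a + 1))).
    by rewrite divr_gt0 ?subr_gt0// mulr_gt0// ltr_wpDl.
  have -> : (1 + (b - a) / (2 * (a + 1))) * a = a + (b - a) * (a / (2 * (a + 1))).
    by field; rewrite gt_eqF// ltr_wpDl.
  rewrite -ltrBrDl gtr_pMr ?subr_gt0// ltr_pdivrMr ?mulr_gt0// ?ltr_wpDl//.
  lra.
exists (C * ((1 + e^-1) / (b - (1 + e) * a))).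
  apply: mulr_gt0; first exact: lt_le_trans C1.
  by rewrite divr_gt0 ?subr_gt0// addr_gt0// invr_gt0.
move=> u y n yt.
apply: (@recursion_bound _ (fun k => r ^+ k / psi (y + k%:R * t)) C (pos y)
  (fun n => growth n yt) (fun k => sqmod (resolvent_fibre u k y))
  (fun k => sqmod (u (y + k%:R * t))) r b e) => //.
- exact: ltW.
- by move=> k; exact: sqmod_ge0.
- by move=> k; exact: sqmod_ge0.
- rewrite /= mul0r addr0 sqmodM sqmodV mulrA mulfV ?sqmod_eq0// mul1r.
  by rewrite ler_peMl ?sqmod_ge0// lerDl invr_ge0 ltW.
move=> k /=; rewrite sqmodM sqmodV mulrA mulfV ?sqmod_eq0// mul1r.
apply: (le_trans (sqmodD_le _ _ e0)); rewrite lerD2l ler_pM2l ?addr_gt0//.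
rewrite (sqmod_ratio adm) le_eqVlt; apply/orP; left; apply/eqP; congr (_ * _).
by rewrite exprS; field; rewrite !gt_eqF// exprn_gt0.
Qed.

Let sqint_resolvent : exists2 D : R, 0 < D & forall u,
  cmeasurable (u : measurableTypeR R -> _) ->
  (sqint mu (glue t (resolvent_fibre u)) <= D%:E * sqint mu u)%E.
Proof.
have [D D0 HD] := resolvent_bound; exists D => // u m_u.
have mR k : cmeasurable (resolvent_fibre u k : measurableTypeR R -> _).
  exact: cmeasurable_resolvent.
have mI : measurable (`[0, t[%classic : set (measurableTypeR R)) by exact: measurable_itv.
have mU (k : nat) : cmeasurable ((fun y => u (y + k%:R * t)) : measurableTypeR R -> _).
  exact: cmeasurable_addr.
have s0 (f : nat -> R -> R[i]) y : (0 <= \sum_(0 <= k <oo) (sqmod (f k y))%:E)%E.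
  by apply: nneseries_ge0 => k _ _; rewrite lee_fin sqmod_ge0.
rewrite sqint_glue// (sqint_fibres t0 m_u) -ge0_integralZl//; last 3 first.
- exact: (measurable_fibre_sum (F := fun k y => u (y + k%:R * t))).
- by move=> y _; exact: (s0 (fun k y => u (y + k%:R * t))).
- by rewrite lee_fin ltW.
apply: ge0_le_integral => //.
- exact: measurable_fibre_sum.
- apply: measurable_funeM.
  exact: (measurable_fibre_sum (F := fun k y => u (y + k%:R * t))).
move=> y yt; apply: nneseries_le_sum => [k|n]; first exact: sqmod_ge0.
apply: (@le_trans _ _ (D%:E * (\sum_(k < n) sqmod (u (y + k%:R * t)))%:E)%E).
  by rewrite -EFinM lee_fin HD.
rewrite lee_pmul2l//.
have := @nneseries_lim_ge R (fun k => (sqmod (u (y + k%:R * t)))%:E) xpredT 0 n.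
by rewrite big_mkord sumEFin; apply=> k _ _; rewrite lee_fin sqmod_ge0.
Qed.

Let glue_resolventE u x : 0 <= x ->
  w * glue t (resolvent_fibre u) x - fwd t psi (glue t (resolvent_fibre u)) x = u x.
Proof.
move=> x0; have [k [y [yt xE]]] := fibre_ex t0 x0.
have [y0 yt'] : 0 <= y /\ y < t by move: yt; rewrite /= in_itv /= => /andP[].
rewrite xE glueE// /fwd; case: k xE => [|k] xE.
  by rewrite mul0r addr0 leNgt yt' /= subr0 mulrA mulfV// mul1r.
have -> : t <= y + k.+1%:R * t.
  by rewrite -natr1 mulrDl mul1r addrA lerDr addr_ge0// mulr_ge0// ltW.
have -> : y + k.+1%:R * t - t = y + k%:R * t by rewrite -natr1; ring.
by rewrite glueE//= mulrA mulfV// mul1r addrK.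
Qed.

(** Only [T (B F) = F] is computed from the recursion. As [S] has no eigenvector, [T] is injective,
    which yields the linearity of [B] and [B (T F) = F]. *)
Lemma resolvent_invertible : ~ spectrum dot S w.
Proof.
rewrite /spectrum /= => /(_ _); apply.
have [D D0 HD] := sqint_resolvent.
pose B (F : L2 mu) : L2 mu := L2class mu (glue t (resolvent_fibre (repr F))).
have BL (F : L2 mu) : glue t (resolvent_fibre (repr F)) \in L2pred mu.
  apply/L2predP; split.
    by apply: cmeasurable_glue => // k; apply: cmeasurable_resolvent; exact: (cmeasurable_repr F).
  apply: (le_lt_trans (HD _ (cmeasurable_repr F))).
  by rewrite lte_mul_pinfty// ?lee_fin ?(ltW D0)// sqint_repr_lty.
have BE F := @L2class_repr _ _ _ mu _ (BL F).
pose T (F : L2 mu) := w *: F - S F.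
have linT : linear T.
  move=> a F G; rewrite /T wtranslation_linear// scalerDr scalerBr !scalerA mulrC.
  by rewrite addrACA opprD.
have TB : cancel B T.
  move=> F; apply: L2_ext.
  have e1 := L2_reprB (w *: B F) (S (B F)).
  have e2 := L2_reprZ w (B F).
  have e3 := wtranslation_repr t0 adm (B F).
  have e4 := ae_Rplus_subr (ltW t0) (BE F).
  apply: filterS2 (filterI e1 e2) (filterI (filterI e3 ae_Rplus_ge0) (filterI (BE F) e4)).
  move=> x [-> ->] [[-> x0] [E1 E2]].
  rewrite -(glue_resolventE (repr F) x0) E1 /fwd.
  by case: ifP => // tx; rewrite E2.
have injT : injective T.
  move=> F G TFG; apply/eqP; rewrite -subr_eq0; apply/eqP.
  apply: (wtranslation_no_eigenvector t0 adm (z := w)).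
  have : T (F - G) = 0.
    by rewrite addrC -scaleN1r linT TFG scaleN1r addNr.
  by move=> /eqP; rewrite subr_eq0 => /eqP.
exists B; split; last exact: TB.
  apply/bounded_operatorP; split.
    by move=> a F G; apply: injT; rewrite TB linT !TB.
  exists D => // F; rewrite -lee_fin EFinM !sqnormE.
  have -> : sqint mu (repr (B F)) = sqint mu (glue t (resolvent_fibre (repr F))).
    apply: sqint_ae (BE F); first exact: cmeasurable_repr.
    by apply: cmeasurable_glue => // k; apply: cmeasurable_resolvent; exact: (cmeasurable_repr F).
  exact: HD (cmeasurable_repr F).
by move=> F; apply: injT; rewrite TB.
Qed.

End Resolvent.

(** The bound [m = |z|^2 (1 - 1/C)] is strictly below [|z|^2]; this strictness is what places the
    whole closed disc in the spectrum. As 0 is in the spectrum, [z] is nonzero. *)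
Lemma resolvent_set_gap (z : R[i]) : ~ spectrum dot S z ->
  exists2 m : R, 0 <= m < sqmod z & forall w, spectrum dot S w -> sqmod w <= m.
Proof.
move=> zS; have z0 : z != 0.
  by apply/negP => /eqP z0; apply: zS; rewrite z0; exact: spectrum_wtranslation0.
have r0 : 0 < sqmod z by rewrite sqmod_gt0.
have [K K0 HK] := resolvent_bounded_below t0 adm zS.
pose C := K * sqmod z.
have growth n y : `[0, t[%classic y ->
    \sum_(j < n.+1) sqmod z ^+ j / psi (y + j%:R * t) <= C * (sqmod z ^+ n / psi (y + n%:R * t)).
  move=> /=; rewrite in_itv /= => yt.
  by have := bounded_below_bshift t0 adm (ltW K0) HK n yt; rewrite sqmod_conj.
have C0 : 0 < C by rewrite mulr_gt0.
have C1 : 1 <= C.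
  apply: (@growth_ge1 _ (fun k => sqmod z ^+ k / psi (0 + k%:R * t))).
    by move=> k; rewrite divr_gt0// exprn_gt0.
  by move=> n; apply: growth; rewrite /= in_itv /= lexx.
exists (sqmod z * (1 - C^-1)).
  rewrite mulr_ge0 ?(ltW r0)//=; last by rewrite subr_ge0 invf_le1.
  by rewrite gtr_pMr// gtrBl invr_gt0.
move=> w wS; rewrite leNgt; apply/negP => rw.
exact: (resolvent_invertible r0 growth rw).
Qed.

End SpectrumDisc.

(** * Eigenvectors of the backward shift *)

Section AdjointEigenvectors.
Context {R : realType} (t : R) (t0 : 0 < t) (psi : R -> R).
Local Notation mu := (@lebesgue_Rplus R).
Local Notation dot := (@L2dot _ _ R mu).
Local Notation psiV := (fun x => (psi x)^-1).
Hypotheses (adm : admissible t psi) (admV : admissible t psiV).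

Let psi0 x : 0 < psi x. Proof. by case: adm. Qed.

Let psi_lower_bound : exists2 m : R, 0 < m & forall y, 0 <= y < t -> m <= psi y.
Proof.
have cpsi : continuous psi by case: adm.
have [c _ Hc] := @EVT_min R psi 0 t (ltW t0) (continuous_subspaceT cpsi).
exists (psi c) => // y /andP[y0 yt]; apply: Hc.
by rewrite in_itv /= y0 ltW.
Qed.

(** The key estimate for [1 / psi] at [1 / z] makes [p k = |z|^(-2k) psi (y + k t)] grow
    geometrically, so its inverses are summable. Their sum is at most [C^2 / p 0 = C^2 / psi y],
    uniformly in [y] since [psi] is bounded below on [[0, t[]. *)
Lemma eigenvector_summable (z : R[i]) :
  (z != 0 -> ~ spectrum dot (bshift t psiV : L2 mu -> L2 mu) z^-1) ->
  exists D : R, forall y, `[0, t[%classic y -> forall n,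
    \sum_(k < n) sqmod z ^+ k / psi (y + k%:R * t) <= D.
Proof.
have [m m0 Hm] := psi_lower_bound.
have [->|z0] := eqVneq z 0.
  (* For [z = 0] only the term of index 0 survives, because [0 ^+ 0 = 1]. *)
  move=> _; exists m^-1 => y /=; rewrite in_itv /= => yt; case=> [|n].
    by rewrite big_ord0 invr_ge0 ltW.
  rewrite big_ord_recl big1 /=; last first.
    by move=> k _; rewrite sqmod0 expr0n /= mul0r.
  by rewrite addr0 expr0 div1r mul0r addr0 lef_pV2 ?posrE// Hm.
move=> /(_ isT) /contrapT /invertible_bounded_below [K K0 HK].
pose r := sqmod z^-1; have r0 : 0 < r by rewrite sqmod_gt0 invr_eq0.
pose C := K * r.
exists (C ^+ 2 / m) => y /=; rewrite in_itv /= => yt n.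
pose p k := r ^+ k * psi (y + k%:R * t).
have p0 k : 0 < p k by rewrite mulr_gt0// exprn_gt0.
have pC k : \sum_(j < k.+1) p j <= C * p k.
  have := bounded_below_bshift t0 admV (ltW K0) HK k yt.
  rewrite invrK; apply: le_trans; rewrite le_eqVlt; apply/orP; left; apply/eqP.
  by apply: eq_bigr => j _; rewrite invrK.
have -> : \sum_(k < n) sqmod z ^+ k / psi (y + k%:R * t) = \sum_(k < n) (p k)^-1.
  by apply: eq_bigr => k _; rewrite /p /r sqmodV invfM exprVn invrK.
apply: (le_trans (sum_inv_growth p0 pC n)).
rewrite ler_wpM2l ?sqr_ge0// lef_pV2 ?posrE// /p expr0 mul1r mul0r addr0.
exact: Hm.
Qed.

(** The formal eigenvector [h] is square integrable by [eigenvector_summable], and nonzero because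
    its level 0 is [psi^(-1/2)], whatever [z] is. *)
Lemma point_spectrum_bshift (z : R[i]) :
  (z != 0 -> ~ spectrum dot (bshift t psiV : L2 mu -> L2 mu) z^-1) ->
  point_spectrum (bshift t psi : L2 mu -> L2 mu) z.
Proof.
move=> /eigenvector_summable[D HD].
pose h (k : nat) (y : R) : R[i] := z ^+ k * (sqrtr (psi (y + k%:R * t)))^-1%:C.
have mh k : cmeasurable (h k : measurableTypeR R -> _).
  apply: cmeasurableM; first exact: cmeasurable_cst.
  apply: cmeasurable_real.
  have := measurableT_comp (continuous_measurable_fun (@sqrt_continuous R))
    (measurableT_comp (measurable_psi admV) (measurable_addr (k%:R * t))).
  by apply: eq_measurable_fun => x _ /=; rewrite sqrtrV ?ltW.
have sqh k y : sqmod (h k y) = sqmod z ^+ k / psi (y + k%:R * t).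
  by rewrite sqmodM sqmodX sqmod_real exprVn sqr_sqrtr ?ltW.
have hL : glue t h \in L2pred mu.
  apply: (@L2_glue _ _ t0 _ D) => // y yt; apply: nneseries_le_sum => [k|n].
    exact: sqmod_ge0.
  rewrite lee_fin; apply: le_trans (HD y yt n).
  by apply: ler_sum => k _; rewrite sqh.
have hE := @L2class_repr _ _ _ mu _ hL; set H := L2class _ _ in hE.
exists H.
  apply: (L2_neq0 t0 hE) => x xt.
  have xt' : `[0, t[%classic x by rewrite /= in_itv.
  have := glueE t0 h 0 xt'; rewrite mul0r addr0 => ->.
  by rewrite -sqmod_eq0 sqh expr0 div1r invr_eq0 gt_eqF.
apply: L2_ext.
apply: filterS2 (filterI (bshift_repr t0 adm H) (L2_reprZ z H))
  (filterI ae_Rplus_ge0 (filterI hE (ae_Rplus_addr (ltW t0) hE))).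
move=> x [-> ->] [/(fibre_ex t0)[k [y [yt xE]]] [E1 E2]].
rewrite /bwd E1 E2 xE.
have -> : y + k%:R * t + t = y + k.+1%:R * t by rewrite -natr1; ring.
rewrite !glueE// /h sqrtrM ?(ltW (psi0 _))// sqrtrV ?(ltW (psi0 _))//.
set a := sqrtr (psi (y + k.+1%:R * t)); set b := sqrtr (psi (y + k%:R * t)).
have [a0 b0] : 0 < a /\ 0 < b by rewrite !sqrtr_gt0.
rewrite mulrCA -rmorphM /=; have -> : a / b * a^-1 = b^-1.
  by field; rewrite !gt_eqF.
by rewrite exprS mulrA.
Qed.

End AdjointEigenvectors.

(** If [1 / z] were in the spectrum, its modulus would be at most the spectral radius, against the
    hypothesis on [z]. *)
Lemma not_in_spectrum_of_radius {R : realType} {H : lmodType R[i]}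
    (dot : {dot H for conjC}) (T : H -> H) (z : R[i]) :
  ((Normc.normc z)%:E < (spectral_radius dot T)^-1)%E -> z != 0 ->
  ~ spectrum dot T z^-1.
Proof.
move=> + z0 zT.
have nz0 : 0 < Normc.normc z by rewrite normc_sqmod sqrtr_gt0 sqmod_gt0.
have : ((Normc.normc z^-1)%:E <= spectral_radius dot T)%E.
  by apply: ereal_sup_ubound; exists z^-1.
rewrite normc_sqmod sqmodV sqrtrV ?sqmod_ge0// -normc_sqmod.
case: (spectral_radius _ _) => [s| |]//.
  rewrite lee_fin => zs; have s0 : 0 < s by apply: lt_le_trans zs; rewrite invr_gt0.
  rewrite inver gt_eqF// lte_fin ltNge -[X in _ <= X]invrK lef_pV2 ?posrE ?invr_gt0//.
  by rewrite zs.
(* An infinite radius has inverse 0, which leaves no room for the modulus of [z]. *)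
by move=> _; rewrite invey lte_fin ltNge ltW.
Qed.

Theorem proposition4p3 (R : realType) (phi : R -> R) (t : R) :
  is_symbol phi -> 0 < t ->
  let dot := L2dot (@lebesgue_Rplus R) in
  let S := wtranslation phi t in
  let L := adjoint dot (cauchy_dual dot S) in
  left_invertible dot S ->
  [/\ point_spectrum S = set0,
      [set z : R[i] | ((Normc.normc z)%:E < (spectral_radius dot L)^-1)%E]
        `<=` point_spectrum (adjoint dot S)
    & spectrum dot S
        = [set z : R[i] | ((Normc.normc z)%:E <= spectral_radius dot S)%E]].
Proof.
move=> sym t0 dot S L Sinv.
have adm := is_symbol_admissible t0 sym.
have SE : S = wtranslation (extend phi) t by rewrite wtranslation_extend.
have admV := left_invertible_admissibleV t0 adm.
move: Sinv; rewrite {}/L SE => /admV {}admV.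
(* From here on [L] is the backward shift for the reciprocal symbol, and the adjoint of [S] the one
   for [extend phi]. *)
rewrite (cauchy_dual_wtranslation t0 adm admV) !adjoint_wtranslation//.
split.
- apply/seteqP; split => // z [F F0 /(wtranslation_no_eigenvector t0 adm) FE].
  by rewrite FE eqxx in F0.
- move=> z /= zL; apply: point_spectrum_bshift => // z0.
  exact: not_in_spectrum_of_radius.
apply/seteqP; split => z /= zS.
  by apply: ereal_sup_ubound; exists z.
(* A [z] outside the spectrum would confine the spectrum to radius [sqrt m < |z|], so the spectral
   radius would be less than [|z|]. *)
apply: contrapT => /(resolvent_set_gap t0 adm) [m /andP[m0 mz] Hm].
move: zS; apply/negP; rewrite -ltNge.
apply: (@le_lt_trans _ _ (sqrtr m)%:E).
  apply: ge_ereal_sup => _ [w wS <-].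
  by rewrite lee_fin normc_sqmod ler_wsqrtr// Hm.
by rewrite lte_fin normc_sqmod ltr_sqrt// (le_lt_trans m0).
Qed.
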